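(* Let $T>0$ and $s\ge0$. Let $q\in L^\infty(0,1)$ be real-valued, let $\mathcal L=-\frac{d^2}{dx^2}+q$ be the Dirichlet Sturm-Liouville operator on $(0,1)$ (whose eigenvalues are assumed positive), and let $a,b,u_0,u_1\in\mathcal D'(0,1)$ with $a,b$ non-negative, such that $a,b$ have non-negative $L^\infty$-moderate regularisations, $u_0$ has a $W^s_{\mathcal L}(0,1)$-moderate regularisation and $u_1$ has an $L^2(0,1)$-moderate regularisation. Then the very weak solution to $$\begin{cases}\partial_t^2u(t,x)+\mathcal L^su(t,x)+a(x)u(t,x)+b(x)u_t(t,x)=0,& (t,x)\in[0,T]\times(0,1),\\ u(0,x)=u_0(x),\quad u_t(0,x)=u_1(x),& x\in(0,1),\\ u(t,0)=u(t,1)=0,& t\in[0,T],\end{cases}$$ is unique in the following sense: for any non-negative $L^\infty$-moderate nets $(a_\varepsilon)_\varepsilon,(\tilde a_\varepsilon)_\varepsilon$ (regularising $a$) and $(b_\varepsilon)_\varepsilon,(\tilde b_\varepsilon)_\varepsilon$ (regularising $b$) such that $(a_\varepsilon-\tilde a_\varepsilon)_\varepsilon$ and $(b_\varepsilon-\tilde b_\varepsilon)_\varepsilon$ are $L^\infty$-negligible, any $W^s_{\mathcal L}$-moderate regularisations $(u_{0,\varepsilon})_\varepsilon,(\tilde u_{0,\varepsilon})_\varepsilon$ of $u_0$ such that $(u_{0,\varepsilon}-\tilde u_{0,\varepsilon})_\varepsilon$ is $W^s_{\mathcal L}$-negligible, and any $L^2$-moderate regularisations $(u_{1,\varepsilon})_\varepsilon,(\tilde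 u_{1,\varepsilon})_\varepsilon$ of $u_1$ such that $(u_{1,\varepsilon}-\tilde u_{1,\varepsilon})_\varepsilon$ is $L^2$-negligible, the net $(u_\varepsilon(t,\cdot)-\tilde u_\varepsilon(t,\cdot))_\varepsilon$ is $L^2$-negligible for all $t\in[0,T]$, where for each $\varepsilon\in(0,1]$ the functions $u_\varepsilon$ and $\tilde u_\varepsilon$ are the solutions of $$\partial_t^2u_\varepsilon+\mathcal L^su_\varepsilon+a_\varepsilon u_\varepsilon+b_\varepsilon\partial_tu_\varepsilon=0,\quad u_\varepsilon(0,\cdot)=u_{0,\varepsilon},\ \partial_tu_\varepsilon(0,\cdot)=u_{1,\varepsilon},\quad u_\varepsilon(t,0)=u_\varepsilon(t,1)=0,$$ $$\partial_t^2\tilde u_\varepsilon+\mathcal L^s\tilde u_\varepsilon+\tilde a_\varepsilon\tilde u_\varepsilon+\tilde b_\varepsilon\partial_t\tilde u_\varepsilon=0,\quad \tilde u_\varepsilon(0,\cdot)=\tilde u_{0,\varepsilon},\ \partial_t\tilde u_\varepsilon(0,\cdot)=\tilde u_{1,\varepsilon},\quad \tilde u_\varepsilon(t,0)=\tilde u_\varepsilon(t,1)=0,$$ on $[0,T]\times(0,1)$.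
   Context: **Operator.** For real $q\in L^\infty(0,1)$, $\mathcal L y=-y''+qy$ with $y(0)=y(1)=0$ is self-adjoint in $L^2(0,1)$; $\lambda_n$, $\phi_n$ ($n\ge1$) denote its eigenvalues and an orthonormal basis of $L^2(0,1)$ of real eigenfunctions. All $\lambda_n$ are positive. For $s\in\mathbb R$, $\mathcal L^s\phi_n=\lambda_n^s\phi_n$ for all $n$, i.e. $\mathcal L^sf=\sum_n\lambda_n^sf_n\phi_n$, $f_n=\int_0^1f\phi_n\,dx$. **Sobolev spaces.** $C^\infty_{\mathcal L}(0,1)=\bigcap_m\mathrm{Dom}(\mathcal L^m)$ with the norms $\max_{j\le m}\|\mathcal L^j\phi\|_{L^2}$; $\mathcal D'_{\mathcal L}(0,1)$ is its continuous dual; $W^s_{\mathcal L}(0,1)=\{f\in\mathcal D'_{\mathcal L}(0,1):\mathcal L^{s/2}f\in L^2(0,1)\}$ with norm $\|f\|_{W^s_{\mathcal L}}=\|\mathcal L^{s/2}f\|_{L^2}$. **Regularisations, moderate and negligible nets.** A regularisation of a distribution $f$ is a net $f_\varepsilon=f*\psi_\varepsilon$, $\varepsilon\in(0,1]$, $\psi_\varepsilon(x)=\varepsilon^{-1}\psi(x/\varepsilon)$, with $\psi\in C_0^\infty(\mathbb R)$, $\psi\ge0$, $\int\psi=1$. A net $(f_\varepsilon)_{\varepsilon\in(0,1]}$ in a normed space $X$ is $X$-moderate if there are $N\in\mathbb N_0$, $C>0$ with $\|f_\varepsilon\|_X\le C\varepsilon^{-N}$ for all $\varepsilon$; it is $X$-negligible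 if for every $k>0$ there is $C_k>0$ with $\|f_\varepsilon\|_X\le C_k\varepsilon^k$ for all $\varepsilon$. **Very weak solution.** A net $(u_\varepsilon)$ of solutions of the regularised problems (for regularisations with the stated moderateness) such that, for some $N\in\mathbb N_0$, $\sup_{t\in[0,T]}(\|u_\varepsilon(t,\cdot)\|_{L^2}+\|\mathcal L^{s/2}u_\varepsilon(t,\cdot)\|_{L^2}+\|\partial_tu_\varepsilon(t,\cdot)\|_{L^2})\le C\varepsilon^{-N}$. **Solution of a regularised problem.** $u_\varepsilon\in C([0,T];W^s_{\mathcal L}(0,1))\cap C^1([0,T];L^2(0,1))$, and the equation is read through eigenfunction coefficients: for every $n$, $u_{\varepsilon,n}(t)=\int_0^1u_\varepsilon(t,x)\phi_n(x)dx$ is twice differentiable with $u_{\varepsilon,n}''+\lambda_n^su_{\varepsilon,n}+\int_0^1(a_\varepsilon u_\varepsilon+b_\varepsilon\partial_tu_\varepsilon)\phi_n\,dx=0$ and the corresponding initial data; the Dirichlet conditions are encoded in the $\phi_n$. *)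

(* Defs.v *)
From mathcomp Require Import all_boot all_order all_algebra.
From mathcomp Require Import complex.
From mathcomp Require Import all_classical all_reals all_analysis.
Set Implicit Arguments.
Unset Strict Implicit.
Unset Printing Implicit Defensive.
Import Order.TTheory GRing.Theory Num.Theory.
Import numFieldNormedType.Exports.
Local Open Scope classical_set_scope.
Local Open Scope ring_scope.
Local Open Scope complex_scope.

(* Functions on (0,1) are represented by total functions on R; every notion
   below looks only at their values on (0,1), and at those on [0,1] for the
   continuous elements of the domain of the operator.  Solutions, Cauchy data
   and distributions are complex-valued; the potential q and the
   eigenfunctions are real-valued. *)

Definition unit_itv (R : realType) : set R := `]0, 1[%classic.
Arguments unit_itv {R}.

Definition cabs (R : realType) (z : R[i]) : R := ComplexField.Normc.normc z.

Definition Lp_norm (R : realType) (p : \bar R) (f : R -> R[i]) : \bar R :=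
  'N[@lebesgue_measure R]_p[(fun x => (cabs (f x))%:E) \_ unit_itv]%E.

Definition Lp (R : realType) (p : \bar R) : set (R -> R[i]) :=
  [set f | [/\ measurable_fun unit_itv (fun x => complex.Re (f x)),
               measurable_fun unit_itv (fun x => complex.Im (f x)) &
               (Lp_norm p f < +oo)%E]].

Definition L2_norm (R : realType) : (R -> R[i]) -> \bar R := Lp_norm 2%:E.
Definition L2 (R : realType) : set (R -> R[i]) := Lp 2%:E.
Definition Loo_norm (R : realType) : (R -> R[i]) -> \bar R := Lp_norm +oo%E.
Definition Loo (R : realType) : set (R -> R[i]) := Lp +oo%E.

Definition toC (R : realType) (f : R -> R) : R -> R[i] := fun x => (f x)%:C.

(* [pairing f] is both the map to the coefficients of f (applied to an
   eigenfunction) and the functional on test functions induced by f. *)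
Definition pairing (R : realType) (f : R -> R[i]) (chi : R -> R) : R[i] :=
  (\int[@lebesgue_measure R]_(x in unit_itv) (complex.Re (f x) * chi x))
  +i* (\int[@lebesgue_measure R]_(x in unit_itv) (complex.Im (f x) * chi x)).

(* [SL_graph q y g]: y is in Dom(L) = H^2(0,1) /\ H^1_0(0,1) and L y = g.
   Here y is the C^1 representative on [0,1], y1 is y' and y2 in L^2 is y'',
   y and y' being the primitives of y' and y''. *)
Definition SL_graph (R : realType) (q y g : R -> R) : Prop :=
  L2 (toC g) /\
  exists y1 y2 : R -> R,
    [/\ L2 (toC y2),
        (forall x : R, 0 <= x <= 1 ->
           y x = y 0 + \int[@lebesgue_measure R]_(t in `[0, x]) y1 t),
        (forall x : R, 0 <= x <= 1 ->
           y1 x = y1 0 + \int[@lebesgue_measure R]_(t in `[0, x]) y2 t),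
        y 0 = 0 /\ y 1 = 0 &
        {ae @lebesgue_measure R, forall x,
           unit_itv x -> g x = - y2 x + q x * y x}].

(* L^m y = g. *)
Fixpoint SL_iter (R : realType) (q : R -> R) (m : nat) (y g : R -> R) : Prop :=
  if m is m'.+1 then exists2 z, SL_graph q y z & SL_iter q m' z g
  else [/\ L2 (toC y), L2 (toC g) &
           {ae @lebesgue_measure R, forall x, unit_itv x -> g x = y x}].

(* Real-valued elements of C^oo_L(0,1): since L has real coefficients,
   C^oo_L(0,1) is the complexification of this real space. *)
Definition CooL (R : realType) (q : R -> R) : set (R -> R) :=
  [set chi | forall m, exists g, SL_iter q m chi g].

Definition R_linear_on (R : realType) (X : set (R -> R))
    (w : (R -> R) -> R[i]) : Prop :=
  forall (c : R) (chi xi : R -> R), X chi -> X xi ->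
    w (fun x => c * chi x + xi x) = c%:C * w chi + w xi.

(* D'_L(0,1).  A complex-linear functional on the complexification is the same
   as a real-linear R[i]-valued functional on the real-valued test functions. *)
Definition DL_dual (R : realType) (q : R -> R) : set ((R -> R) -> R[i]) :=
  [set w | R_linear_on (CooL q) w /\
    exists (m : nat) (C : R), forall (chi : R -> R) (g : nat -> R -> R),
      CooL q chi -> (forall j, (j <= m)%N -> SL_iter q j chi (g j)) ->
      ((cabs (w chi))%:E <=
        C%:E * \big[maxe/0]_(j < m.+1) L2_norm (toC (g j)))%E].

(* g = sum_n lambda_n^r w(phi_n) phi_n, with convergence in L^2(0,1). *)
Definition SL_pow (R : realType) (lambda : nat -> R) (phi : nat -> R -> R)
    (r : R) (w : (R -> R) -> R[i]) (g : R -> R[i]) : Prop :=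
  L2 g /\
  (fun N : nat => L2_norm (fun x =>
     g x - \sum_(n < N) (lambda n `^ r)%:C * w (phi n) * (phi n x)%:C))
    @ \oo --> 0%E.

(* The eigenvalues of L and an orthonormal basis of L^2(0,1) consisting of real
   eigenfunctions. *)
Definition SL_eigenbasis (R : realType) (q : R -> R) (lambda : nat -> R)
    (phi : nat -> R -> R) : Prop :=
  [/\ (forall n, SL_graph q (phi n) (fun x => lambda n * phi n x)),
      (forall n m, pairing (toC (phi n)) (phi m) = (n == m)%:R) &
      (forall f, L2 f ->
         (fun N : nat => L2_norm (fun x =>
            f x - \sum_(n < N) pairing f (phi n) * (phi n x)%:C))
           @ \oo --> 0%E)].

Definition W_dist (R : realType) (q : R -> R) (lambda : nat -> R)
    (phi : nat -> R -> R) (s : R) : set ((R -> R) -> R[i]) :=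
  [set w | DL_dual q w /\ exists g, SL_pow lambda phi (s / 2) w g].

Definition W_dist_norm (R : realType) (lambda : nat -> R)
    (phi : nat -> R -> R) (s : R) (w : (R -> R) -> R[i]) : \bar R :=
  L2_norm (xget (fun=> 0) [set g | SL_pow lambda phi (s / 2) w g]).

(* Elements of W^s_L given by functions.  Only s >= 0 is used, for which
   W^s_L(0,1) is contained in L^2(0,1), so that [L2 f] is no restriction. *)
Definition W (R : realType) (q : R -> R) (lambda : nat -> R)
    (phi : nat -> R -> R) (s : R) : set (R -> R[i]) :=
  [set f | L2 f /\ W_dist q lambda phi s (pairing f)].

Definition W_norm (R : realType) (lambda : nat -> R)
    (phi : nat -> R -> R) (s : R) (f : R -> R[i]) : \bar R :=
  W_dist_norm lambda phi s (pairing f).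

(* Real-valued elements of C_0^oo(Omega). *)
Definition test_function (R : realType) (Omega : set R) : set (R -> R) :=
  [set chi | (forall n x, derivable (derive1n n chi) x 1) /\
    exists K : set R, [/\ compact K, K `<=` Omega &
      forall x, ~ K x -> chi x = 0]].

(* D'(Omega); see [DL_dual] for the use of real-valued test functions. *)
Definition distribution_on (R : realType) (Omega : set R) :
    set ((R -> R) -> R[i]) :=
  [set F | R_linear_on (test_function Omega) F /\
    forall K : set R, compact K -> K `<=` Omega ->
    exists (m : nat) (C : R), forall (chi : R -> R) (M : R),
      test_function Omega chi -> (forall x, ~ K x -> chi x = 0) ->
      (forall j x, (j <= m)%N -> `|derive1n j chi x| <= M) ->
      cabs (F chi) <= C * M].

(* The order of R[i] makes [0 <= z] mean that z is real and non-negative. *)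
Definition nonneg_distribution (R : realType) (Omega : set R)
    (F : (R -> R) -> R[i]) : Prop :=
  forall chi, test_function Omega chi -> (forall x, 0 <= chi x) -> 0 <= F chi.

Definition mollifier (R : realType) : set (R -> R) :=
  [set psi | [/\ test_function setT psi, (forall x, 0 <= psi x) &
    (\int[@lebesgue_measure R]_x (psi x)%:E = 1)%E]].

Definition scaled (R : realType) (psi : R -> R) (eps : R) : R -> R :=
  fun x => eps^-1 * psi (x / eps).

Definition convolution (R : realType) (F : (R -> R) -> R[i]) (psi : R -> R) :
    R -> R[i] :=
  fun x => F (fun y => psi (x - y)).

(* For f in D'(0,1), f * psi_eps is not defined near the endpoints of (0,1);
   the convolution is that of an extension of f to a distribution on R. *)
Definition regularisation (R : realType) (f : (R -> R) -> R[i])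
    (net : R -> R -> R[i]) : Prop :=
  exists (F : (R -> R) -> R[i]) (psi : R -> R),
    [/\ distribution_on setT F,
        (forall chi, test_function unit_itv chi -> F chi = f chi),
        mollifier psi &
        forall eps x : R, 0 < eps <= 1 -> unit_itv x ->
          net eps x = convolution F (scaled psi eps) x].

Definition nonneg_net (R : realType) (net : R -> R -> R[i]) : Prop :=
  forall eps x : R, 0 < eps <= 1 -> unit_itv x -> 0 <= net eps x.

Definition net_sub (R : realType) (f g : R -> R -> R[i]) : R -> R -> R[i] :=
  fun eps x => f eps x - g eps x.

(* A normed space is given by its carrier X and its norm. *)
Definition moderate_net (R : realType) (X : set (R -> R[i]))
    (nrm : (R -> R[i]) -> \bar R) (net : R -> R -> R[i]) : Prop :=
  (forall eps : R, 0 < eps <= 1 -> X (net eps)) /\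
  exists (N : nat) (C : R), 0 < C /\
    forall eps : R, 0 < eps <= 1 -> (nrm (net eps) <= (C * eps ^- N)%:E)%E.

Definition negligible_net (R : realType) (X : set (R -> R[i]))
    (nrm : (R -> R[i]) -> \bar R) (net : R -> R -> R[i]) : Prop :=
  (forall eps : R, 0 < eps <= 1 -> X (net eps)) /\
  forall k : R, 0 < k -> exists C : R, 0 < C /\
    forall eps : R, 0 < eps <= 1 -> (nrm (net eps) <= (C * eps `^ k)%:E)%E.

(* Filter of t' -> t with t' in [0,T] and t' <> t (one-sided at 0 and T). *)
Definition time_nbhs (R : realType) (T t : R) : set_system R :=
  within [set t' | 0 <= t' <= T /\ t' != t] (nbhs t).

(* C([0,T]; X) *)
Definition continuous_in_time (R : realType) (X : set (R -> R[i]))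
    (nrm : (R -> R[i]) -> \bar R) (T : R) (u : R -> R -> R[i]) : Prop :=
  forall t : R, 0 <= t <= T -> X (u t) /\
    (fun t' => nrm (fun x => u t' x - u t x)) @ time_nbhs T t --> 0%E.

(* v is the derivative of u : [0,T] -> X in the norm of X. *)
Definition derivative_in_time (R : realType)
    (nrm : (R -> R[i]) -> \bar R) (T : R) (u v : R -> R -> R[i]) : Prop :=
  forall t : R, 0 <= t <= T ->
    (fun t' => nrm (fun x =>
       ((t' - t)^-1)%:C * (u t' x - u t x) - v t x))
      @ time_nbhs T t --> 0%E.

Definition scalar_derivative (R : realType) (T : R) (f g : R -> R[i]) : Prop :=
  forall t : R, 0 <= t <= T ->
    (fun t' => cabs (((t' - t)^-1)%:C * (f t' - f t) - g t))
      @ time_nbhs T t --> (0 : R).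

(* u'' + L^s u + a u + b u' = 0, u(0) = u0, u'(0) = u1, with Dirichlet
   conditions, read through the coefficients on the eigenfunctions;
   v is the time derivative of u. *)
Definition wave_solution (R : realType) (q : R -> R) (lambda : nat -> R)
    (phi : nat -> R -> R) (T s : R) (a b u0 u1 : R -> R[i])
    (u : R -> R -> R[i]) : Prop :=
  continuous_in_time (W q lambda phi s) (W_norm lambda phi s) T u /\
  exists v : R -> R -> R[i],
    [/\ continuous_in_time (@L2 R) (@L2_norm R) T u,
        derivative_in_time (@L2_norm R) T u v,
        continuous_in_time (@L2 R) (@L2_norm R) T v &
        forall n, exists d d2 : R -> R[i],
          [/\ scalar_derivative T (fun t => pairing (u t) (phi n)) d,
              scalar_derivative T d d2,
              (forall t : R, 0 <= t <= T ->
                 d2 t + (lambda n `^ s)%:C * pairing (u t) (phi n)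
                 + pairing (fun x => a x * u t x + b x * v t x) (phi n) = 0),
              pairing (u 0) (phi n) = pairing u0 (phi n) &
              d 0 = pairing u1 (phi n)]].

(* Main.v *)
Require Import Defs.
From HB Require Import structures.
From mathcomp Require Import all_boot all_order all_algebra.
From mathcomp Require Import complex.
From mathcomp Require Import all_classical all_reals all_analysis.
From mathcomp Require Import measurable_realfun ess_sup_inf.
From mathcomp Require Import ring lra.
Set Implicit Arguments.
Unset Strict Implicit.
Unset Printing Implicit Defensive.
Import Order.TTheory GRing.Theory Num.Theory.
Import numFieldNormedType.Exports.
Local Open Scope classical_set_scope.
Local Open Scope ring_scope.

(** The coefficients, the potential and the eigenfunctions are real, so the real
    and the imaginary part of a solution solve the same equation separately
    ([wave_solution_part]).  They are treated as curves in the real vector space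
    [l2] of square-integrable functions with its semi-inner product.

    The comparison is an energy estimate.  If w'' + L^s w + a w + b w' = f with
    a, b >= 0, then E = |w'|^2 + |L^(s/2) w|^2 + <a w, w> satisfies
    E' = - 2 <b w', w'> + 2 <f, w'> <= 2 |f| |w'|, whence
    sup |w'|^2 <= 2 E(0) + 4 T^2 sup |f|^2 ([energy_estimate]).  The sizes of a
    and b enter only through E(0), and polynomially.  This is the decisive point:
    an estimate by Gronwall's lemma would cost the exponential of a negative
    power of epsilon, which no negligible quantity absorbs.  The curve w' need
    not take values in W^s, and the equation is known through its coefficients
    only, so the energy is truncated to the first n modes.  The truncation leaves
    an error 2 <a w + b w' - f, w' - P_n w'>, which is uniformly small because a
    continuous curve on [0, T] has compact range ([proj_uniform]); the mean value
    inequality [tderiv_le] replaces integration in time.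

    The estimate is used twice ([difference_bound]): without a source it shows
    that one of the two solutions, u', is moderate; then it is applied to the
    difference w = u - u', which solves the equation of u with the source
    f = - (a - a') u' - (b - b') v', where v' is the velocity of u'.  This source
    is negligible, being the product of negligible and moderate factors, and so
    are the initial data of w ([bound_arith]).

    Finally, smallness of the initial position in W^s gives smallness in L^2
    only because the eigenvalues are bounded away from 0
    ([eigenvalue_lower_bound]), which their positivity alone does not say.  An
    eigenfunction phi_n of norm 1 satisfies 1 <= 2 |g_n|, where g_n is the
    primitive of phi_n'' = (q - lambda_n) phi_n vanishing at 0.  The values of
    g_n are inner products of phi_n with the indicators of the intervals [0, t]
    and with their multiples by q, so by Bessel's inequality the |g_n|^2
    belonging to the eigenvalues lambda_n <= 1 have a finite sum, and there are
    only finitely many of them. *)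

(** * Semi-inner-product spaces *)

(** A symmetric, bilinear, positive semi-definite form.  Definiteness is not
    required, so that functions need not be identified almost everywhere. *)
Definition semi_inner (R : realType) (V : lmodType R) (ip : V -> V -> R) :=
  [/\ forall u v, ip u v = ip v u,
      forall c u v w, ip (c *: u + v) w = c * ip u w + ip v w &
      forall u, 0 <= ip u u].

Section SemiInner.
Context (R : realType) (V : lmodType R) (ip : V -> V -> R).
Hypothesis Hip : semi_inner ip.

(** The seminorm of the form. *)
Definition snorm (v : V) : R := Num.sqrt (ip v v).

(** Convergence in the seminorm along a filter. *)
Definition scvg (I : Type) (F : set_system I) (p : I -> V) (l : V) : Prop :=
  (fun i => snorm (p i - l)) @ F --> (0 : R).

Lemma ipC u v : ip u v = ip v u. Proof. by case: Hip. Qed.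
Lemma ip_ge0 u : 0 <= ip u u. Proof. by case: Hip. Qed.
Lemma ipDl u v w : ip (u + v) w = ip u w + ip v w.
Proof. by case: Hip => _ L _; rewrite -[u]scale1r L mul1r scale1r. Qed.
Lemma ip0l w : ip 0 w = 0.
Proof. by have := ipDl 0 0 w; rewrite addr0 => /eqP; rewrite -subr_eq0; lra. Qed.
Lemma ipZl c u w : ip (c *: u) w = c * ip u w.
Proof. by case: Hip => _ L _; rewrite -[c *: u]addr0 L ip0l addr0. Qed.
Lemma ipNl u w : ip (- u) w = - ip u w.
Proof. by rewrite -scaleN1r ipZl mulN1r. Qed.
Lemma ipBl u v w : ip (u - v) w = ip u w - ip v w.
Proof. by rewrite ipDl ipNl. Qed.
Lemma ipDr u v w : ip w (u + v) = ip w u + ip w v.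
Proof. by rewrite !(ipC w) ipDl. Qed.
Lemma ipZr c u w : ip w (c *: u) = c * ip w u.
Proof. by rewrite !(ipC w) ipZl. Qed.
Lemma ipBr u v w : ip w (u - v) = ip w u - ip w v.
Proof. by rewrite !(ipC w) ipBl. Qed.
Lemma ip_suml (I : Type) (r : seq I) (P : pred I) (g : I -> V) w :
  ip (\sum_(i <- r | P i) g i) w = \sum_(i <- r | P i) ip (g i) w.
Proof. by elim/big_ind2: _ => [|? ? ? ? <- <-|//]; rewrite ?ip0l ?ipDl. Qed.
Lemma ip_sumr (I : Type) (r : seq I) (P : pred I) (g : I -> V) w :
  ip w (\sum_(i <- r | P i) g i) = \sum_(i <- r | P i) ip w (g i).
Proof. by rewrite ipC ip_suml; apply: eq_bigr => i _; rewrite ipC. Qed.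

Lemma snorm_ge0 v : 0 <= snorm v. Proof. exact: sqrtr_ge0. Qed.
Lemma sqr_snorm v : snorm v ^+ 2 = ip v v.
Proof. by rewrite sqr_sqrtr ?ip_ge0. Qed.

Lemma cauchy_schwarz_sqr u v : ip u v ^+ 2 <= ip u u * ip v v.
Proof.
have H t : 0 <= ip u u - 2 * t * ip u v + t ^+ 2 * ip v v.
  have := ip_ge0 (u - t *: v).
  by rewrite ipBl !ipBr !ipZl !ipZr (ipC v u); congr (0 <= _); ring.
have [v0|v0] := eqVneq (ip v v) 0.
- (* a degenerate v is orthogonal to everything: the quadratic is affine *)
  rewrite v0 mulr0; have [->|u0] := eqVneq (ip u v) 0; first by rewrite expr0n.
  have := H ((ip u u + 1) / (2 * ip u v)); rewrite v0 mulr0 addr0.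
  suff -> : 2 * ((ip u u + 1) / (2 * ip u v)) * ip u v = ip u u + 1 by lra.
  by field.
- have v1 : 0 < ip v v by rewrite lt_def v0 ip_ge0.
  have := H (ip u v / ip v v).
  have -> : ip u u - 2 * (ip u v / ip v v) * ip u v
      + (ip u v / ip v v) ^+ 2 * ip v v = ip u u - ip u v ^+ 2 / ip v v.
    by field.
  by rewrite subr_ge0 ler_pdivrMr.
Qed.

Lemma cauchy_schwarz u v : `|ip u v| <= snorm u * snorm v.
Proof.
rewrite -sqrtrM ?ip_ge0 // -sqrtr_sqr ler_wsqrtr //.
exact: cauchy_schwarz_sqr.
Qed.

Lemma ip_le_snorm u v : ip u v <= snorm u * snorm v.
Proof. exact: le_trans (ler_norm _) (cauchy_schwarz u v). Qed.

Lemma snormZ c v : snorm (c *: v) = `|c| * snorm v.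
Proof.
rewrite /snorm ipZl ipZr mulrA -expr2 sqrtrM ?sqr_ge0 //.
by rewrite sqrtr_sqr.
Qed.

Lemma snormN v : snorm (- v) = snorm v.
Proof. by rewrite -scaleN1r snormZ normrN1 mul1r. Qed.

Lemma snormB u v : snorm (u - v) = snorm (v - u).
Proof. by rewrite -snormN opprB. Qed.

Lemma snorm0 : snorm 0 = 0.
Proof. by rewrite /snorm ip0l sqrtr0. Qed.

Lemma ler_snormD u v : snorm (u + v) <= snorm u + snorm v.
Proof.
rewrite -(@ler_pXn2r _ 2) ?nnegrE ?addr_ge0 ?snorm_ge0 //.
rewrite sqr_snorm ipDl !ipDr (ipC v u) sqrrD !sqr_snorm.
have := ip_le_snorm u v; lra.
Qed.

Lemma sqr_snormD_le u v : snorm (u + v) ^+ 2 <= 2 * snorm u ^+ 2 + 2 * snorm v ^+ 2.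
Proof.
have := ip_ge0 (u - v).
rewrite !sqr_snorm ipBl !ipBr ipDl !ipDr (ipC v u); lra.
Qed.

Lemma scvg_ip (I : Type) (F : set_system I) {FF : Filter F} (p r : I -> V) p0 r0 :
  scvg F p p0 -> scvg F r r0 -> (fun i => ip (p i) (r i)) @ F --> ip p0 r0.
Proof.
move=> cp cr; apply/subr_cvg0/norm_cvg0P.
pose B i := snorm (p i - p0) * snorm (r i - r0)
  + snorm (p i - p0) * snorm r0 + snorm p0 * snorm (r i - r0).
have cB : B i @[i --> F] --> (0 : R).
  have -> : (0 : R) = 0 * 0 + 0 * snorm r0 + snorm p0 * 0.
    by rewrite !mul0r !mulr0 !addr0.
  by do 2?[apply: cvgD]; apply: cvgM => //; apply: cvg_cst.
apply: squeeze_cvgr cB; last by apply: cvg_cst.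
apply: nearW => i; rewrite normr_ge0 /=.
have -> : ip (p i) (r i) - ip p0 r0 =
    ip (p i - p0) (r i - r0) + ip (p i - p0) r0 + ip p0 (r i - r0).
  by rewrite !ipBl !ipBr; ring.
apply: le_trans (ler_normD _ _) _; apply: lerD; last exact: cauchy_schwarz.
by apply: le_trans (ler_normD _ _) _; apply: lerD; exact: cauchy_schwarz.
Qed.

Lemma scvg_near (I : Type) (F : set_system I) {FF : Filter F} (p q : I -> V) l :
  (\forall i \near F, p i = q i) -> scvg F p l -> scvg F q l.
Proof.
move=> pq; apply: cvg_trans; apply: near_eq_cvg.
by apply: filterS pq => i /= ->.
Qed.

(** A map that is Lipschitz for the seminorm preserves convergence. *)
Lemma scvg_bounded (I : Type) (F : set_system I) {FF : Filter F} (p : I -> V) l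
    (a : V -> V) (M : R) :
  (forall u v, snorm (a u - a v) <= M * snorm (u - v)) ->
  scvg F p l -> scvg F (fun i => a (p i)) (a l).
Proof.
move=> aM cp; have cB : M * snorm (p i - l) @[i --> F] --> (0 : R).
  by rewrite -(mulr0 M); apply: cvgM => //; apply: cvg_cst.
apply: squeeze_cvgr cB; last by apply: cvg_cst.
by apply: nearW => i; rewrite snorm_ge0 aM.
Qed.

Lemma scvgD (I : Type) (F : set_system I) {FF : Filter F} (p r : I -> V) p0 r0 :
  scvg F p p0 -> scvg F r r0 -> scvg F (fun i => p i + r i) (p0 + r0).
Proof.
move=> cp cr; have cB : snorm (p i - p0) + snorm (r i - r0) @[i --> F] --> (0 : R).
  by rewrite -(addr0 0); apply: cvgD.
apply: squeeze_cvgr cB; last by apply: cvg_cst.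
by apply: nearW => i; rewrite snorm_ge0 opprD addrACA ler_snormD.
Qed.

Lemma scvgB (I : Type) (F : set_system I) {FF : Filter F} (p r : I -> V) p0 r0 :
  scvg F p p0 -> scvg F r r0 -> scvg F (fun i => p i - r i) (p0 - r0).
Proof.
move=> cp cr; apply: scvgD => //.
apply: (@scvg_bounded _ _ _ _ _ (fun v => - v) 1) cr => u v.
by rewrite mul1r -opprD snormN.
Qed.

Lemma scvg_near_le (I : Type) (F : set_system I) {FF : Filter F} (p : I -> V) l
    (e : R) :
  scvg F p l -> 0 < e -> \forall i \near F, snorm (p i - l) <= e.
Proof.
move=> cp e0.
have H : \forall i \near F, `|snorm (p i - l)| <= e.
  exact: (cvgr0_norm_le _ cp _ e0).
apply: filterS H => i; rewrite ger0_norm ?snorm_ge0 //.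
Qed.

Lemma scvg_cst (I : Type) (F : set_system I) {FF : Filter F} p : scvg F (fun=> p) p.
Proof. by rewrite /scvg subrr snorm0; apply: cvg_cst. Qed.

(** ** Orthonormal systems *)

Section Orthonormal.
Variable phi : nat -> V.
Hypothesis Hphi : forall n m, ip (phi n) (phi m) = (n == m)%:R.

(** The orthogonal projection onto the first [n] basis vectors. *)
Definition proj (n : nat) (v : V) : V := \sum_(i < n) ip v (phi i) *: phi i.

Lemma ip_proj_phi n v (i : 'I_n) : ip (proj n v) (phi i) = ip v (phi i).
Proof.
rewrite ip_suml (bigD1 i) //= ipZl Hphi eqxx mulr1 big1 ?addr0 // => j ji.
by rewrite ipZl Hphi val_eqE (negbTE ji) mulr0.
Qed.

Lemma ip_proj n u v : ip u (proj n v) = \sum_(i < n) ip u (phi i) * ip v (phi i).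
Proof. by rewrite ip_sumr; apply: eq_bigr => i _; rewrite ipZr mulrC. Qed.

Lemma ip_projr_proj n v : ip (proj n v) (proj n v) = \sum_(i < n) ip v (phi i) ^+ 2.
Proof. by rewrite ip_proj; apply: eq_bigr => i _; rewrite ip_proj_phi expr2. Qed.

Lemma sqr_snorm_sub_proj n v :
  snorm (v - proj n v) ^+ 2 = snorm v ^+ 2 - \sum_(i < n) ip v (phi i) ^+ 2.
Proof.
rewrite !sqr_snorm ipBl !ipBr ip_projr_proj (ipC (proj n v)) ip_proj.
under eq_bigr do rewrite -expr2.
by rewrite subrr subr0.
Qed.

Lemma bessel n v : \sum_(i < n) ip v (phi i) ^+ 2 <= snorm v ^+ 2.
Proof. by rewrite -subr_ge0 -sqr_snorm_sub_proj sqr_ge0. Qed.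

Lemma snorm_sub_proj_le n v : snorm (v - proj n v) <= snorm v.
Proof.
rewrite -(@ler_pXn2r _ 2) ?nnegrE ?snorm_ge0 // sqr_snorm_sub_proj.
by rewrite lerBlDr lerDl sumr_ge0 // => i _; rewrite sqr_ge0.
Qed.

Lemma proj_sub n u v : proj n (u - v) = proj n u - proj n v.
Proof. by rewrite -sumrB; apply: eq_bigr => i _; rewrite ipBl scalerBl. Qed.

Hypothesis phi_complete : forall v, scvg \oo (fun n => proj n v) v.

Lemma parseval v :
  (fun n => \sum_(i < n) ip v (phi i) ^+ 2) @ \oo --> snorm v ^+ 2.
Proof.
have H : ip v (proj n v) @[n --> \oo] --> ip v v.
  by apply: scvg_ip; [exact: scvg_cst|exact: phi_complete].
rewrite sqr_snorm; apply: cvg_trans H; apply: near_eq_cvg; apply: nearW => n.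
by rewrite /= ip_proj; apply: eq_bigr => i _; rewrite expr2.
Qed.

Lemma parseval_le (c K : R) (mu : nat -> R) v : 0 < c ->
  (forall n, c <= mu n) ->
  (forall n, \sum_(i < n) mu i * ip v (phi i) ^+ 2 <= K) ->
  snorm v ^+ 2 <= c^-1 * K.
Proof.
move=> c0 cmu H; apply: (cvgr_to_le (@parseval v)); apply: nearW => n.
rewrite mulrC ler_pdivlMr // mulrC; apply: le_trans (H n).
by rewrite mulr_sumr ler_sum // => i _; rewrite ler_wpM2r ?sqr_ge0.
Qed.

End Orthonormal.

End SemiInner.

(** * Derivatives on a compact time interval *)

Section TimeDerivative.
Context (R : realType) (T : R).
Hypothesis T_gt0 : 0 < T.

(** [l] is the derivative at [t] of the restriction of [g] to [[0, T]]. *)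
Definition tderiv (g : R -> R) (t l : R) : Prop :=
  (fun t' => (t' - t)^-1 * (g t' - g t)) @ time_nbhs T t --> l.

#[local] Instance time_nbhs_filter t : Filter (time_nbhs T t).
Proof. exact: within_filter. Qed.

Lemma time_nbhs_in t : \forall t' \near time_nbhs T t, 0 <= t' <= T /\ t' != t.
Proof. exact: withinT. Qed.

(** At every point of [[0, T]], the punctured neighbourhoods are non-trivial. *)
Lemma time_nbhs_proper t : 0 <= t <= T -> ProperFilter (time_nbhs T t).
Proof.
move=> /andP[t0 tT]; split; last exact: time_nbhs_filter.
move=> /nbhs_ballP[e /= e0 He].
have [tT'|Tt] := ltP t T.
- pose d := Num.min (e / 2) (T - t).
  have d0 : 0 < d by rewrite lt_min subr_gt0 tT' divr_gt0.
  apply: (He (t + d)).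
    rewrite /ball /= opprD addrA subrr sub0r normrN gtr0_norm //.
    by rewrite gt_min ltr_pdivrMr // mulr2n mulrDr mulr1 ltrDl e0.
  have dT : d <= T - t by rewrite ge_min lexx orbT.
  by split; [apply/andP; split; lra|rewrite gt_eqF // ltrDl].
- pose d := Num.min (e / 2) T.
  have d0 : 0 < d by rewrite lt_min T_gt0 divr_gt0.
  apply: (He (t - d)).
    rewrite /ball /= opprB addrC subrK gtr0_norm //.
    by rewrite gt_min ltr_pdivrMr // mulr2n mulrDr mulr1 ltrDl e0.
  have dT : d <= T by rewrite ge_min lexx orbT.
  by split; [apply/andP; split; lra|rewrite lt_eqF // ltrBlDr ltrDl].
Qed.

Lemma time_nbhs_sub0 t : (fun t' : R => t' - t) @ time_nbhs T t --> (0 : R).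
Proof.
apply: (cvg_trans (cvg_app _ (cvg_within _))).
by rewrite -(subrr t); apply: cvgB; [exact: cvg_id|exact: cvg_cst].
Qed.

Lemma tderiv_unique g t l l' : 0 <= t <= T ->
  tderiv g t l -> tderiv g t l' -> l = l'.
Proof.
move=> /time_nbhs_proper FF gl gl'.
exact: (cvg_unique _ gl gl').
Qed.

Lemma tderiv_cvg g t l : tderiv g t l -> g @ time_nbhs T t --> g t.
Proof.
move=> gl; apply/subr_cvg0.
have : (t' - t) * ((t' - t)^-1 * (g t' - g t)) @[t' --> time_nbhs T t] --> 0 * l.
  by apply: cvgM => //; exact: time_nbhs_sub0.
rewrite mul0r; apply: cvg_trans; apply: near_eq_cvg.
apply: filterS (time_nbhs_in t) => t' [_ tt].
by rewrite mulVKf // subr_eq0.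
Qed.

Lemma tderiv_cst c t : tderiv (fun=> c) t 0.
Proof.
rewrite /tderiv; under eq_fun do rewrite subrr mulr0; exact: cvg_cst.
Qed.

Lemma tderivD g h t l m :
  tderiv g t l -> tderiv h t m -> tderiv (fun t => g t + h t) t (l + m).
Proof.
move=> gl hm; rewrite /tderiv.
under eq_fun do rewrite opprD addrACA mulrDr.
exact: cvgD.
Qed.

Lemma tderivZ c g t l : tderiv g t l -> tderiv (fun t => c * g t) t (c * l).
Proof.
move=> gl; rewrite /tderiv.
under eq_fun do rewrite -mulrBr mulrCA.
by apply: cvgM => //; exact: cvg_cst.
Qed.

Lemma tderiv_sum n (g : 'I_n -> R -> R) t (l : 'I_n -> R) :
  (forall i, tderiv (g i) t (l i)) ->
  tderiv (fun t => \sum_(i < n) g i t) t (\sum_(i < n) l i).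
Proof.
elim: n g l => [|n IH] g l H.
  under eq_fun do rewrite big_ord0.
  by rewrite big_ord0; exact: tderiv_cst.
under eq_fun do rewrite big_ord_recr /=.
by rewrite big_ord_recr /=; apply: tderivD => //; exact: IH.
Qed.

Lemma tderiv_sqr g t l : tderiv g t l -> tderiv (fun t => g t ^+ 2) t (2 * g t * l).
Proof.
move=> gl; rewrite /tderiv.
have -> : 2 * g t * l = (g t + g t) * l by ring.
under eq_fun => t' do have -> : (t' - t)^-1 * (g t' ^+ 2 - g t ^+ 2) =
  (g t' + g t) * ((t' - t)^-1 * (g t' - g t)) by ring.
by apply: cvgM => //; apply: cvgD; [exact: tderiv_cvg gl|exact: cvg_cst].
Qed.

(** The mean value inequality for functions differentiable on [[0, T]]. *)
Lemma tderiv_le g dg C : (forall t : R, 0 <= t <= T -> tderiv g t (dg t)) ->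
  (forall t : R, 0 <= t <= T -> dg t <= C) ->
  forall t : R, 0 <= t <= T -> g t <= g 0 + C * t.
Proof.
move=> Hg HC t /andP[t0 tT].
have dr x : x \in `]0, t[%R -> is_derive x 1 g (dg x).
  rewrite in_itv /= => /andP[x0 xt].
  have xT : 0 <= x <= T by apply/andP; split; lra.
  have sh : (fun h : R => h *: 1 + x) @ 0^' --> time_nbhs T x.
    move=> A /nbhs_ballP[e /= e0 HA].
    pose d := Num.min e (Num.min x (T - x)).
    have d0 : 0 < d by rewrite !lt_min e0 x0 subr_gt0 /=; lra.
    exists d => //= h /=; rewrite sub0r normrN => hd h0.
    move: hd; rewrite !lt_min => /and3P[he hx hT].
    apply: HA.
      by rewrite /ball /= opprD addrCA subrr addr0 normrN /GRing.scale /= mulr1.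
    move: hx hT; rewrite !ltr_norml /GRing.scale /= mulr1 => /andP[? ?] /andP[? ?].
    split; first by apply/andP; split; lra.
    by rewrite -subr_eq0 addrK.
  have cv : (fun h : R => h^-1 *: (g (h *: 1 + x) - g x)) @ 0^' --> dg x.
    have := cvg_comp _ _ sh (Hg _ xT).
    apply: cvg_trans; apply: near_eq_cvg; apply: nearW => h.
    by rewrite /= addrK /GRing.scale /= mulr1.
  by split; [apply/cvg_ex; exists (dg x)|exact: (cvg_lim _ cv)].
have ct : {within `[0, t], continuous g}.
  apply/subspace_continuousP => x /=; rewrite in_itv /= => /andP[x0 xt].
  have xT : 0 <= x <= T by apply/andP; split; lra.
  move=> A gA; have H1 : nbhs x [set y | 0 <= y <= T /\ y != x -> A (g y)].
    exact: tderiv_cvg (Hg _ xT) _ gA.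
  change (nbhs x [set y | `[0, t]%classic y -> A (g y)]).
  apply: filterS H1 => y H /=; rewrite in_itv /= => /andP[y0 yt].
  have [->|yx] := eqVneq y x; first exact: nbhs_singleton.
  by apply: H; split => //; apply/andP; split; lra.
have [c] := MVT_segment t0 dr ct.
rewrite in_itv /= subr0 => /andP[c0 ct'] E.
have : dg c <= C by apply: HC; apply/andP; split; lra.
by move=> /(ler_wpM2r t0); rewrite -E; lra.
Qed.

Section VectorValued.
Context (V : lmodType R) (ip : V -> V -> R).
Hypothesis Hip : semi_inner ip.

(** [z] is the derivative at [t] of [w : [0, T] -> V] in the seminorm. *)
Definition vderiv (w : R -> V) (t : R) (z : V) : Prop :=
  scvg ip (time_nbhs T t) (fun t' => (t' - t)^-1 *: (w t' - w t)) z.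

Lemma vderiv_cvg w t z : vderiv w t z -> scvg ip (time_nbhs T t) w (w t).
Proof.
move=> wz; have cB : `|t' - t| * (snorm ip ((t' - t)^-1 *: (w t' - w t) - z)
    + snorm ip z) @[t' --> time_nbhs T t] --> (0 : R).
  rewrite -(mul0r (0 + snorm ip z)); apply: cvgM.
    by rewrite -(normr0 R); apply: cvg_norm; exact: time_nbhs_sub0.
  by apply: cvgD => //; exact: cvg_cst.
apply: squeeze_cvgr cB; last exact: cvg_cst.
apply: filterS (time_nbhs_in t) => t' [_ tt].
rewrite snorm_ge0 /=.
set y := _ *: (w t' - w t).
have -> : w t' - w t = (t' - t) *: y.
  by rewrite scalerA divff ?subr_eq0 // scale1r.
rewrite (snormZ Hip) ler_wpM2l ?normr_ge0 // -{1}(subrK z y).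
exact: (ler_snormD Hip).
Qed.

Lemma tderiv_ip e w t z : vderiv w t z -> tderiv (fun t => ip (w t) e) t (ip z e).
Proof.
move=> wz; rewrite /tderiv.
under eq_fun do rewrite -(ipBl Hip) -(ipZl Hip).
by apply: (scvg_ip Hip) => //; exact: scvg_cst.
Qed.

Lemma vderivB w w' t z z' : vderiv w t z -> vderiv w' t z' ->
  vderiv (fun t => w t - w' t) t (z - z').
Proof.
move=> wz wz'; apply: scvg_near (scvgB Hip wz wz'); apply: nearW => t'.
by rewrite -scalerBr; congr (_ *: _); rewrite !opprD addrACA.
Qed.

(** Derivative of the quadratic form of a bounded symmetric operator. *)
Lemma tderiv_quadratic (a : V -> V) (M : R) w t z :
  (forall u v, a (u - v) = a u - a v) ->
  (forall u v, ip (a u) v = ip u (a v)) ->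
  (forall u, snorm ip (a u) <= M * snorm ip u) ->
  vderiv w t z ->
  tderiv (fun t => ip (a (w t)) (w t)) t (2 * ip (a (w t)) z).
Proof.
move=> aB aS aM wz; rewrite /tderiv.
have -> : 2 * ip (a (w t)) z = ip (a (w t) + a (w t)) z.
  by rewrite (ipDl Hip); ring.
under eq_fun => t'.
  have -> : (t' - t)^-1 * (ip (a (w t')) (w t') - ip (a (w t)) (w t)) =
      ip (a (w t') + a (w t)) ((t' - t)^-1 *: (w t' - w t)).
    rewrite (ipZr Hip) (ipDl Hip) !(ipBr Hip); congr (_ * _).
    by rewrite [ip (a (w t)) (w t')]aS (ipC Hip (w t) (a (w t'))); ring.
  over.
apply: (scvg_ip Hip) => //; apply: (scvgD Hip); last exact: scvg_cst.
apply: (@scvg_bounded _ _ _ _ _ _ _ _ a M); last exact: vderiv_cvg wz.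
by move=> u v; rewrite -aB aM.
Qed.

(** A curve with speed at most [Z] moves by at most [Z] times the time. *)
Lemma vderiv_bound w z (Z : R) : (forall t : R, 0 <= t <= T -> vderiv w t (z t)) ->
  (forall t : R, 0 <= t <= T -> snorm ip (z t) <= Z) ->
  forall t : R, 0 <= t <= T -> snorm ip (w t - w 0) <= Z * t.
Proof.
move=> wz zZ t tT; set e := w t - w 0.
have Z0 : 0 <= Z := le_trans (snorm_ge0 _ _) (zZ _ tT).
have t0 : 0 <= t by case/andP: tT.
have [->|e0] := eqVneq (snorm ip e) 0; first exact: mulr_ge0.
have := @tderiv_le (fun t => ip (w t) e) (fun t => ip (z t) e) (Z * snorm ip e)
  (fun t tT => @tderiv_ip e w t (z t) (wz t tT)) _ _ tT.
rewrite -lerBlDl -(ipBl Hip) -(sqr_snorm Hip) expr2 mulrAC ler_pM2r; last first.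
  by rewrite lt_def e0 snorm_ge0.
apply => s sT; apply: le_trans (ip_le_snorm Hip _ _) _.
by rewrite ler_wpM2r ?snorm_ge0 ?zZ.
Qed.

Lemma sqr_snorm_curve_le w z (Z : R) :
  (forall t : R, 0 <= t <= T -> vderiv w t (z t)) ->
  (forall t : R, 0 <= t <= T -> snorm ip (z t) <= Z) ->
  forall t : R, 0 <= t <= T ->
  snorm ip (w t) ^+ 2 <= 2 * snorm ip (w 0) ^+ 2 + 2 * T ^+ 2 * Z ^+ 2.
Proof.
move=> wz zZ t tT.
have Z0 : 0 <= Z := le_trans (snorm_ge0 _ _) (zZ _ tT).
case/andP: (tT) => t0 t1.
rewrite -{1}(subrK (w 0) (w t)) addrC.
apply: le_trans (sqr_snormD_le Hip _ _) _; rewrite lerD2l -mulrA ler_pM2l //.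
rewrite -exprMn ler_pXn2r ?nnegrE ?snorm_ge0 ?mulr_ge0 ?(ltW T_gt0) //.
apply: le_trans (vderiv_bound wz zZ tT) _.
by rewrite mulrC ler_wpM2r.
Qed.

(** A continuous curve on [[0, T]] is bounded. *)
Lemma curve_bounded w :
  (forall t : R, 0 <= t <= T -> scvg ip (time_nbhs T t) w (w t)) ->
  exists2 M, 0 <= M & forall t : R, 0 <= t <= T -> snorm ip (w t) <= M.
Proof.
move=> cw.
have /compact_near_coveringP/near_covering_withinP cov := @segment_compact R 0 T.
have H : \forall M \near +oo, `[0, T]%classic `<=` (fun t => snorm ip (w t) <= M).
  apply: cov => t /=; rewrite in_itv /= => tT.
  have H1 : nbhs t [set t' | 0 <= t' <= T /\ t' != t ->
    snorm ip (w t' - w t) <= 1].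
    exact: (scvg_near_le (cw t tT) ltr01).
  exists ([set t' | 0 <= t' <= T -> snorm ip (w t') <= 1 + snorm ip (w t)],
          [set M | 1 + snorm ip (w t) <= M]) => /=.
    split; last by apply: nbhs_pinfty_ge; rewrite num_real.
    apply: filterS H1 => t' H t'T.
    have [->|tt] := eqVneq t' t; first by rewrite lerDr.
    have H' := H (conj t'T tt).
    rewrite -{1}(subrK (w t) (w t')); apply: le_trans (ler_snormD Hip _ _) _.
    by rewrite lerD2r.
  by move=> [t' M] /= [H HM]; rewrite in_itv /= => t'T; apply: le_trans (H t'T) HM.
have [M [M0 HM]] : exists M, 0 <= M /\
    `[0, T]%classic `<=` (fun t => snorm ip (w t) <= M).
  near +oo_R => M; exists M; split; first by near: M; apply: nbhs_pinfty_ge.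
  by near: M.
by exists M => // t tT; apply: HM; rewrite /= in_itv.
Unshelve. all: by end_near. Qed.

(** The projections onto a complete orthonormal system converge uniformly along
    a continuous curve on [[0, T]], since its range is compact. *)
Lemma proj_uniform (phi : nat -> V) w (d : R) :
  (forall n m, ip (phi n) (phi m) = (n == m)%:R) ->
  (forall v, scvg ip \oo (fun n => proj ip phi n v) v) ->
  (forall t : R, 0 <= t <= T -> scvg ip (time_nbhs T t) w (w t)) -> 0 < d ->
  \forall n \near \oo, forall t : R, 0 <= t <= T ->
    snorm ip (w t - proj ip phi n (w t)) <= d.
Proof.
move=> ortho cpl cw d0.
have /compact_near_coveringP/near_covering_withinP cov := @segment_compact R 0 T.
have H : \forall n \near \oo, `[0, T]%classic `<=`
    (fun t => snorm ip (w t - proj ip phi n (w t)) <= d).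
  apply: cov => t /=; rewrite in_itv /= => tT.
  have d2 : 0 < d / 2 by rewrite divr_gt0.
  have H1 : nbhs t [set t' | 0 <= t' <= T /\ t' != t ->
    snorm ip (w t' - w t) <= d / 2].
    exact: (scvg_near_le (cw t tT) d2).
  have H2 : \forall n \near \oo, snorm ip (proj ip phi n (w t) - w t) <= d / 2.
    exact: (scvg_near_le (cpl (w t)) d2).
  exists ([set t' | 0 <= t' <= T -> snorm ip (w t' - w t) <= d / 2],
          [set n | snorm ip (w t - proj ip phi n (w t)) <= d / 2]) => /=.
    split.
      apply: filterS H1 => t' H t'T.
      have [->|tt] := eqVneq t' t; first by rewrite subrr (snorm0 Hip) ltW.
      exact: (H (conj t'T tt)).
    by apply: filterS H2 => n; rewrite (snormB Hip).
  move=> [t' n] /= [H HM]; rewrite in_itv /= => t'T.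
  have -> : w t' - proj ip phi n (w t') =
      ((w t' - w t) - proj ip phi n (w t' - w t)) + (w t - proj ip phi n (w t)).
    by rewrite (proj_sub Hip) opprB [RHS]addrAC !addrA !subrK.
  apply: le_trans (ler_snormD Hip _ _) _; rewrite [leRHS](splitr d) lerD //.
  exact: le_trans (snorm_sub_proj_le Hip ortho _ _) (H t'T).
by apply: filterS H => n H t tT; apply: H; rewrite /= in_itv.
Qed.

End VectorValued.
End TimeDerivative.

(** * The energy estimate *)

(** The setting is the equation w'' + mu w + a w + b w' = f, read through the
    coefficients on a complete orthonormal system on which the leading operator
    is diagonal with eigenvalues [mu n]; [z] is the velocity w'. *)
Section Energy.
Context (R : realType) (T : R) (V : lmodType R) (ip : V -> V -> R).
Hypothesis T_gt0 : 0 < T.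
Hypothesis Hip : semi_inner ip.
Variables (phi : nat -> V) (mu : nat -> R).
Hypothesis Hphi : forall n m, ip (phi n) (phi m) = (n == m)%:R.
Hypothesis phi_complete : forall v, scvg ip \oo (fun n => proj ip phi n v) v.
Hypothesis mu_ge0 : forall n, 0 <= mu n.
Variables (a b : V -> V) (Ma Mb : R).
Hypothesis aB : forall u v, a (u - v) = a u - a v.
Hypothesis a_sym : forall u v, ip (a u) v = ip u (a v).
Hypothesis a_ge0 : forall u, 0 <= ip (a u) u.
Hypothesis a_bnd : forall u, snorm ip (a u) <= Ma * snorm ip u.
Hypothesis b_ge0 : forall u, 0 <= ip (b u) u.
Hypothesis b_bnd : forall u, snorm ip (b u) <= Mb * snorm ip u.
Variables (w z f : R -> V) (F K : R).
Hypothesis wz : forall t : R, 0 <= t <= T -> vderiv T ip w t (z t).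
Hypothesis z_cont : forall t : R, 0 <= t <= T -> scvg ip (time_nbhs T t) z (z t).
Hypothesis z_eq : forall n (t : R), 0 <= t <= T ->
  tderiv T (fun t => ip (z t) (phi n)) t
    (- (mu n * ip (w t) (phi n) + ip (a (w t) + b (z t) - f t) (phi n))).
Hypothesis f_bnd : forall t : R, 0 <= t <= T -> snorm ip (f t) <= F.
Hypothesis w0_energy : forall n, \sum_(i < n) mu i * ip (w 0) (phi i) ^+ 2 <= K.

(** The energy of the first [n] modes, together with the whole potential energy
    of the operator [a]. *)
Let energy n t := \sum_(i < n) (ip (z t) (phi i) ^+ 2 + mu i * ip (w t) (phi i) ^+ 2)
  + ip (a (w t)) (w t).

Let h t := a (w t) + b (z t) - f t.

Let tderiv_energy n (t : R) : 0 <= t <= T -> tderiv T (energy n) t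
  (2 * ip (h t) (z t - proj ip phi n (z t)) - 2 * ip (b (z t)) (z t)
   + 2 * ip (f t) (z t)).
Proof.
move=> tT.
have -> : 2 * ip (h t) (z t - proj ip phi n (z t)) - 2 * ip (b (z t)) (z t)
   + 2 * ip (f t) (z t) =
   \sum_(i < n) (2 * ip (z t) (phi i)
       * - (mu i * ip (w t) (phi i) + ip (h t) (phi i))
     + mu i * (2 * ip (w t) (phi i) * ip (z t) (phi i)))
   + 2 * ip (a (w t)) (z t).
  rewrite (ipBr Hip) (ip_proj Hip).
  rewrite (_ : ip (h t) (z t) =
    ip (a (w t)) (z t) + ip (b (z t)) (z t) - ip (f t) (z t)); last first.
    by rewrite (ipBl Hip) (ipDl Hip).
  rewrite (_ : \sum_(i < n) (2 * ip (z t) (phi i) * _ + _) =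
    - (2 * \sum_(i < n) ip (h t) (phi i) * ip (z t) (phi i))); first by ring.
  by rewrite mulr_sumr -sumrN; apply: eq_bigr => i _; ring.
apply: tderivD; last exact: (tderiv_quadratic Hip aB a_sym a_bnd (wz tT)).
apply: tderiv_sum => i; apply: tderivD.
  by apply: tderiv_sqr; exact: z_eq.
by apply: tderivZ; apply: tderiv_sqr; apply: (tderiv_ip Hip); exact: wz.
Qed.

Let energy0_le n :
  energy n 0 <= snorm ip (z 0) ^+ 2 + K + ip (a (w 0)) (w 0).
Proof.
rewrite /energy big_split /= lerD2r; apply: lerD; last exact: w0_energy.
by apply: (bessel Hip Hphi).
Qed.

Let sqr_snorm_le_energy n (t : R) :
  snorm ip (z t) ^+ 2 <= energy n t + snorm ip (z t - proj ip phi n (z t)) ^+ 2.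
Proof.
rewrite (sqr_snorm_sub_proj Hip Hphi) /energy big_split /=.
have := a_ge0 (w t).
have : 0 <= \sum_(i < n) mu i * ip (w t) (phi i) ^+ 2.
  by apply: sumr_ge0 => i _; rewrite mulr_ge0 ?sqr_ge0.
lra.
Qed.

(** The estimate in terms of an a priori bound [Z] on the velocity. *)
Let sqr_snorm_velocity_le Z : (forall t : R, 0 <= t <= T -> snorm ip (z t) <= Z) ->
  forall t : R, 0 <= t <= T -> snorm ip (z t) ^+ 2 <=
    snorm ip (z 0) ^+ 2 + K + ip (a (w 0)) (w 0) + 2 * F * Z * T.
Proof.
move=> zZ t tT.
have [Mw Mw0 wMw] : exists2 M, 0 <= M &
    forall t : R, 0 <= t <= T -> snorm ip (w t) <= M.
  by apply: (curve_bounded Hip) => s sT; exact: (vderiv_cvg Hip (wz sT)).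
have Z0 : 0 <= Z := le_trans (snorm_ge0 _ _) (zZ _ tT).
have F0 : 0 <= F := le_trans (snorm_ge0 _ _) (f_bnd tT).
pose H := `|Ma| * Mw + `|Mb| * Z + F.
have H0 : 0 <= H by rewrite /H !addr_ge0 // mulr_ge0.
have hH (s : R) : 0 <= s <= T -> snorm ip (h s) <= H.
  move=> sT; rewrite /h /H.
  apply: le_trans (ler_snormD Hip _ _) _; rewrite (snormN Hip) lerD ?f_bnd //.
  apply: le_trans (ler_snormD Hip _ _) _; apply: lerD.
    apply: le_trans (a_bnd _) _; apply: le_trans (ler_norm _) _.
    by rewrite normrM ler_wpM2l // ger0_norm ?snorm_ge0 ?wMw.
  apply: le_trans (b_bnd _) _; apply: le_trans (ler_norm _) _.
  by rewrite normrM ler_wpM2l // ger0_norm ?snorm_ge0 ?zZ.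
(* [d] bounds the truncation error of the velocity and is sent to 0 below *)
have main (d : R) : 0 < d -> snorm ip (z t) ^+ 2 <=
    snorm ip (z 0) ^+ 2 + K + ip (a (w 0)) (w 0) + 2 * F * Z * T
      + (2 * H * T + d) * d.
  move=> d0.
  have [n _ Hn] := proj_uniform Hip Hphi phi_complete z_cont d0.
  have {}Hn (s : R) : 0 <= s <= T -> snorm ip (z s - proj ip phi n (z s)) <= d.
    exact: (Hn n (leqnn n)).
  have dE (s : R) : 0 <= s <= T -> 2 * ip (h s) (z s - proj ip phi n (z s))
      - 2 * ip (b (z s)) (z s) + 2 * ip (f s) (z s) <= 2 * (H * d) + 2 * (F * Z).
    move=> sT; have := b_ge0 (z s).
    have : ip (h s) (z s - proj ip phi n (z s)) <= H * d.
      apply: le_trans (ip_le_snorm Hip _ _) _.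
      by rewrite ler_pM ?snorm_ge0 ?hH ?Hn.
    have : ip (f s) (z s) <= F * Z.
      apply: le_trans (ip_le_snorm Hip _ _) _.
      by rewrite ler_pM ?snorm_ge0 ?f_bnd ?zZ.
    lra.
  have := tderiv_le (tderiv_energy (n := n)) dE tT.
  have := sqr_snorm_le_energy n t; have := energy0_le n.
  have : snorm ip (z t - proj ip phi n (z t)) ^+ 2 <= d ^+ 2.
    by rewrite ler_pXn2r ?nnegrE ?snorm_ge0 ?Hn // ltW.
  have : (2 * (H * d) + 2 * (F * Z)) * t <= (2 * (H * d) + 2 * (F * Z)) * T.
    case/andP: tT => _ tT; rewrite ler_wpM2l //.
    by rewrite addr_ge0 // mulr_ge0 // mulr_ge0 // ltW.
  have -> : (2 * H * T + d) * d = 2 * (H * d) * T + d ^+ 2 by ring.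
  lra.
apply/ler_addgt0Pr => e e0.
pose c := 2 * H * T + 1.
have c1 : 1 <= c by rewrite lerDr !mulr_ge0 // ltW.
pose d := Num.min 1 (e / c).
have c0 : 0 < c by lra.
have d0 : 0 < d by rewrite lt_min ltr01 divr_gt0.
have d1 : d <= 1 by rewrite ge_min lexx.
apply: le_trans (main d d0) _; rewrite lerD2l.
apply: (@le_trans _ _ (c * d)); first by rewrite ler_wpM2r ?(ltW d0) // lerD2l.
by rewrite mulrC -ler_pdivlMr // ge_min lexx orbT.
Qed.

(** The velocity is controlled by the initial energy and the source alone: the
    bound involves neither [Ma] nor [Mb], except through [a] at the initial
    time. *)
Lemma energy_estimate (t : R) : 0 <= t <= T ->
  snorm ip (z t) ^+ 2 <=
    2 * (snorm ip (z 0) ^+ 2 + K + ip (a (w 0)) (w 0)) + 4 * T ^+ 2 * F ^+ 2.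
Proof.
have [Z Z0 zZ] := curve_bounded Hip z_cont.
have zT : (0 : R) <= 0 <= T by rewrite lexx /= ltW.
have F0 : 0 <= F := le_trans (snorm_ge0 _ _) (f_bnd zT).
pose S := [set snorm ip (z t) | t in [set t : R | 0 <= t <= T]].
have S0 : has_sup S.
  split; first by exists (snorm ip (z 0)), 0.
  by exists Z => _ [s sT <-]; exact: zZ.
have zS s : 0 <= s <= T -> snorm ip (z s) <= sup S.
  by move=> sT; apply: sup_upper_bound => //; exists s.
set A := snorm ip (z 0) ^+ 2 + K + ip (a (w 0)) (w 0).
have sS : 0 <= sup S := le_trans (snorm_ge0 _ _) (zS _ zT).
have key : sup S ^+ 2 <= A + 2 * F * sup S * T.
  have Y : 0 <= A + 2 * F * sup S * T.
    by apply: le_trans (sqr_snorm_velocity_le zS zT); exact: sqr_ge0.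
  rewrite -(sqr_sqrtr Y) ler_pXn2r ?nnegrE ?sqrtr_ge0 //.
  apply: sup_le_ub; first by case: S0.
  move=> _ [s sT <-]; rewrite -(@ler_pXn2r _ 2) ?nnegrE ?sqrtr_ge0 ?snorm_ge0 //.
  by rewrite (sqr_sqrtr Y); exact: sqr_snorm_velocity_le.
move=> tT; apply: (@le_trans _ _ (sup S ^+ 2)).
  by rewrite ler_pXn2r ?nnegrE ?snorm_ge0 ?zS.
(* [key] is a quadratic inequality for the supremum; complete the square *)
have := sqr_ge0 (sup S - 2 * (T * F)); rewrite sqrrB exprMn; lra.
Qed.

(** The same estimate in terms of bounds on the data; the second one also
    controls the solution itself, since the [mu n] are bounded from below. *)
Lemma energy_data_estimate (c k t : R) : 0 < c -> (forall n, c <= mu n) ->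
  0 <= Ma -> snorm ip (z 0) <= k -> 0 <= t <= T ->
  let E := 2 * (k ^+ 2 + K + Ma * (c^-1 * K)) + 4 * T ^+ 2 * F ^+ 2 in
  snorm ip (z t) ^+ 2 <= E /\
  snorm ip (w t) ^+ 2 <= 2 * (c^-1 * K) + 2 * T ^+ 2 * E.
Proof.
move=> c0 cmu Ma0 z0k tT E.
have w0K : snorm ip (w 0) ^+ 2 <= c^-1 * K.
  exact: (parseval_le Hip phi_complete c0 cmu).
have zE r : 0 <= r <= T -> snorm ip (z r) ^+ 2 <= E.
  move=> rT; apply: le_trans (energy_estimate rT) _.
  have : snorm ip (z 0) ^+ 2 <= k ^+ 2.
    by rewrite ler_pXn2r ?nnegrE ?snorm_ge0 // (le_trans _ z0k) ?snorm_ge0.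
  have : ip (a (w 0)) (w 0) <= Ma * (c^-1 * K).
    apply: le_trans (ip_le_snorm Hip _ _) _.
    apply: (@le_trans _ _ (Ma * snorm ip (w 0) * snorm ip (w 0))).
      by rewrite ler_wpM2r ?snorm_ge0.
    by rewrite -mulrA -expr2 ler_wpM2l.
  rewrite /E; lra.
split; first exact: zE.
have E0 : 0 <= E := le_trans (sqr_ge0 _) (zE t tT).
have := sqr_snorm_curve_le T_gt0 Hip wz (Z := Num.sqrt E) _ tT.
rewrite (sqr_sqrtr E0) => H.
apply: (@le_trans _ _ (2 * snorm ip (w 0) ^+ 2 + 2 * T ^+ 2 * E)).
  apply: H => r rT; rewrite -(@ler_pXn2r _ 2) ?nnegrE ?snorm_ge0 ?sqrtr_ge0 //.
  by rewrite (sqr_sqrtr E0) zE.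
by rewrite lerD2r ler_pM2l.
Qed.

End Energy.

(** * Real square-integrable functions on (0,1) *)

Section L2Real.
Context {R : realType}.
Local Notation mu := (@lebesgue_measure R).
Implicit Types f g : R -> R.

Lemma measurable_unit_itv : measurable (@unit_itv R : set (measurableTypeR R)).
Proof. exact: measurable_itv. Qed.
#[local] Hint Resolve measurable_unit_itv : core.

Lemma ae_mono (P Q : R -> Prop) : (forall x, P x -> Q x) ->
  {ae mu, forall x, P x} -> {ae mu, forall x, Q x}.
Proof.
move=> PQ; apply: filterS => //; first exact: (ae_filter_ringOfSetsType mu).
Qed.

(** [f] is measurable and square-integrable on (0,1). *)
Definition sq_integrable f : Prop :=
  measurable_fun unit_itv f /\ mu.-integrable unit_itv (fun x => (f x ^+ 2)%:E).

Lemma integrable_mul f g : sq_integrable f -> sq_integrable g ->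
  mu.-integrable unit_itv (fun x => (f x * g x)%:E).
Proof.
move=> [mf f2] [mg g2].
have fg := integrableD measurable_unit_itv f2 g2.
apply: le_integrable fg => //.
  by apply/measurable_EFinP; exact: measurable_funM.
move=> x _ /=; rewrite lee_fin [leRHS]ger0_norm ?addr_ge0 ?sqr_ge0 // ler_norml.
have := sqr_ge0 (f x + g x); have := sqr_ge0 (f x - g x).
have := sqr_ge0 (f x); have := sqr_ge0 (g x).
rewrite sqrrB sqrrD; move=> *; apply/andP; split; lra.
Qed.

Lemma sq_integrable0 : sq_integrable (0 : R -> R).
Proof.
split; first exact: measurable_cst.
by under eq_fun do rewrite expr0n /=; exact: integrable0.
Qed.

Lemma sq_integrable_lin c f g :
  sq_integrable f -> sq_integrable g -> sq_integrable (fun x => c * f x + g x).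
Proof.
move=> hf hg; have [mf f2] := hf; have [mg g2] := hg; split.
  by apply: measurable_funD => //; apply: measurable_funM.
have fg := integrable_mul hf hg.
have := integrableD measurable_unit_itv
  (integrableD measurable_unit_itv (integrableZl measurable_unit_itv (c ^+ 2) f2)
    (integrableZl measurable_unit_itv (2 * c) fg)) g2.
apply: eq_integrable => // x _ /=.
by rewrite -!EFinM -!EFinD; congr (_%:E); ring.
Qed.

(** The subspace of the square-integrable functions on the unit interval. *)
Definition l2_pred : {pred R -> R} := mem [set f | sq_integrable f].

Lemma l2_predP f : f \in l2_pred <-> sq_integrable f.
Proof. by rewrite inE. Qed.

Fact l2_submod_closed : submod_closed l2_pred.
Proof.
split; first by rewrite inE; exact: sq_integrable0.
by move=> c f g; rewrite !inE => hf hg; exact: sq_integrable_lin.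
Qed.
HB.instance Definition _ := GRing.isSubmodClosed.Build R (R -> R) l2_pred
  l2_submod_closed.

(** The vector space of square-integrable functions; functions equal almost
    everywhere are not identified. *)
Record l2 := L2Fun { l2_val : R -> R; l2_valP : l2_val \in l2_pred }.
HB.instance Definition _ := [isSub for l2_val].
HB.instance Definition _ := [Choice of l2 by <:].
HB.instance Definition _ := [SubChoice_isSubLmodule of l2 by <:].

Lemma l2P (u : l2) : sq_integrable (val u).
Proof. by apply/l2_predP; exact: l2_valP. Qed.

(** The element of [l2] given by [f], and 0 if [f] is not square-integrable. *)
Definition to_l2 f : l2 := insubd (0 : l2) f.

Lemma to_l2K f : sq_integrable f -> val (to_l2 f) = f.
Proof. by move=> /l2_predP h; rewrite insubdK. Qed.

(** The inner product of L^2(0,1). *)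
Definition l2_ip (u v : l2) : R := \int[mu]_(x in unit_itv) (val u x * val v x).

Lemma l2_semi_inner : semi_inner l2_ip.
Proof.
split.
- by move=> u v; apply: eq_Rintegral => x _; rewrite mulrC.
- move=> c u v w; rewrite /l2_ip -RintegralZl //; last first.
    exact: integrable_mul (l2P u) (l2P w).
  rewrite -RintegralD //; last 2 first.
  + exact: (integrableZl measurable_unit_itv c (integrable_mul (l2P u) (l2P w))).
  + exact: integrable_mul (l2P v) (l2P w).
  by apply: eq_Rintegral => x _; rewrite linearP /= mulrDl mulrA.
- by move=> u; apply: Rintegral_ge0 => x _; rewrite -expr2 sqr_ge0.
Qed.

Lemma sqr_l2_norm (u : l2) :
  ((snorm l2_ip u ^+ 2)%:E = \int[mu]_(x in unit_itv) (val u x ^+ 2)%:E)%E.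
Proof.
rewrite (sqr_snorm l2_semi_inner) /l2_ip /Rintegral fineK.
  by apply: eq_integral => x _; rewrite expr2.
by apply: integrable_fin_num => //; exact: integrable_mul (l2P u) (l2P u).
Qed.

Lemma l2_ip_ae (u u' v : l2) :
  {ae mu, forall x, unit_itv x -> val u x = val u' x} -> l2_ip u v = l2_ip u' v.
Proof.
move=> uu'; congr fine; apply: ae_eq_integral => //.
- by apply/measurable_EFinP; apply: measurable_funM; [case: (l2P u)|case: (l2P v)].
- by apply/measurable_EFinP; apply: measurable_funM; [case: (l2P u')|case: (l2P v)].
- by apply: ae_mono uu' => x H /H ->.
Qed.

(** ** Multiplication by an essentially bounded function *)

Section Multiplication.
Variables (a : R -> R) (M : R).
Hypothesis ma : measurable_fun unit_itv a.
Hypothesis M0 : 0 <= M.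
Hypothesis aM : {ae mu, forall x, unit_itv x -> `|a x| <= M}.

Lemma integral_sqr_mul_le f : sq_integrable f ->
  (\int[mu]_(x in unit_itv) ((a x * f x) ^+ 2)%:E <=
   \int[mu]_(x in unit_itv) ((M * f x) ^+ 2)%:E)%E.
Proof.
move=> [mf f2]; apply: ae_ge0_le_integral => //.
- by move=> x _; rewrite lee_fin sqr_ge0.
- by apply/measurable_EFinP; apply: measurable_funX; exact: measurable_funM.
- by move=> x _; rewrite lee_fin sqr_ge0.
- apply/measurable_EFinP; apply: measurable_funX.
  by apply: measurable_funM => //; exact: measurable_cst.
- apply: ae_mono aM => x H /H ax; rewrite lee_fin !exprMn.
  by rewrite ler_wpM2r ?sqr_ge0 // -real_normK ?num_real // ler_pXn2r ?nnegrE.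
Qed.

Lemma sq_integrable_mul f : sq_integrable f -> sq_integrable (fun x => a x * f x).
Proof.
move=> hf; have [mf f2] := hf; split; first exact: measurable_funM.
apply/integrableP; split.
  by apply/measurable_EFinP; apply: measurable_funX; exact: measurable_funM.
under eq_integral do rewrite /= ger0_norm ?sqr_ge0 //.
apply: le_lt_trans (integral_sqr_mul_le hf) _.
have [_ hM] : sq_integrable (fun x => M * f x + 0).
  exact: (@sq_integrable_lin M f _ hf sq_integrable0).
move/integrableP: hM => [_]; congr (_ < _)%E; apply: eq_integral => x _ /=.
by rewrite addr0 ger0_norm ?sqr_ge0.
Qed.

(** Multiplication by the essentially bounded function [a] on [l2]. *)
Definition l2_mul (u : l2) : l2 := to_l2 (fun x => a x * val u x).

Lemma l2_mulE u : val (l2_mul u) = (fun x => a x * val u x).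
Proof. by rewrite to_l2K //; apply: sq_integrable_mul; exact: l2P. Qed.

Lemma l2_mulB u v : l2_mul (u - v) = l2_mul u - l2_mul v.
Proof.
apply: val_inj; apply/funext => x.
have E (p r : l2) : val (p - r) x = val p x - val r x by [].
by rewrite E !l2_mulE E mulrBr.
Qed.

Lemma l2_mul_sym u v : l2_ip (l2_mul u) v = l2_ip u (l2_mul v).
Proof.
by apply: eq_Rintegral => x _; rewrite !l2_mulE mulrCA mulrA.
Qed.

Lemma l2_mul_ge0 u : (forall x, unit_itv x -> 0 <= a x) -> 0 <= l2_ip (l2_mul u) u.
Proof.
move=> a0; apply: Rintegral_ge0 => x /a0 ax.
by rewrite l2_mulE -mulrA mulr_ge0 // -expr2 sqr_ge0.
Qed.

Lemma l2_mul_norm u : snorm l2_ip (l2_mul u) <= M * snorm l2_ip u.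
Proof.
rewrite -(@ler_pXn2r _ 2) ?nnegrE ?mulr_ge0 ?snorm_ge0 //.
rewrite -(ger0_norm M0) -(snormZ l2_semi_inner).
rewrite -lee_fin !sqr_l2_norm l2_mulE.
apply: le_trans (integral_sqr_mul_le (l2P u)) _.
by rewrite linearZ /=.
Qed.

End Multiplication.
End L2Real.

(** * Real and imaginary parts *)

Section Parts.
Context {R : realType}.
Local Open Scope complex_scope.
Local Notation mu := (@lebesgue_measure R).
Implicit Types (f g h : R -> R[i]) (c : bool).

(** The real part for [true] and the imaginary part for [false], so that both
    are treated at once. *)
Definition part c (z : R[i]) : R := if c then complex.Re z else complex.Im z.

Arguments part : simpl never.

Lemma partD c z1 z2 : part c (z1 + z2) = part c z1 + part c z2.
Proof. by case: c z1 z2 => [] [? ?] [? ?]. Qed.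

Lemma partB c z1 z2 : part c (z1 - z2) = part c z1 - part c z2.
Proof. by case: c z1 z2 => [] [? ?] [? ?]. Qed.

Lemma part_sum c (I : Type) (r : seq I) (P : pred I) (F : I -> R[i]) :
  part c (\sum_(i <- r | P i) F i) = \sum_(i <- r | P i) part c (F i).
Proof.
elim/big_ind2: _ => [|? ? ? ? <- <-|//]; first by case: c.
exact: partD.
Qed.

Lemma partM c (a z : R[i]) :
  complex.Im a = 0 -> part c (a * z) = complex.Re a * part c z.
Proof. by case: c a z => [] [? ?] [? ?]; rewrite /part /= => ->; ring. Qed.

Lemma part_realM c (a : R) z : part c (a%:C * z) = a * part c z.
Proof. exact: partM. Qed.

Lemma part_mulr c (z : R[i]) (a : R) : part c (z * a%:C) = part c z * a.
Proof. by rewrite mulrC part_realM mulrC. Qed.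

Lemma cabs_sqr z : cabs z ^+ 2 = part true z ^+ 2 + part false z ^+ 2 :> R.
Proof. by case: z => x y; rewrite /cabs /= sqr_sqrtr // addr_ge0 ?sqr_ge0. Qed.

Lemma cabs_ge0 z : 0 <= cabs z :> R.
Proof. by case: z => x y; exact: sqrtr_ge0. Qed.

Lemma part_le_cabs c z : `|part c z| <= cabs z.
Proof.
rewrite -(@ler_pXn2r _ 2) ?nnegrE ?cabs_ge0 // real_normK ?num_real // cabs_sqr.
by case: c; rewrite ?lerDl ?lerDr sqr_ge0.
Qed.

Lemma L2_normE h : L2_norm h =
  ((\int[mu]_(x in unit_itv) (part true (h x) ^+ 2 + part false (h x) ^+ 2)%:E)
    `^ 2^-1)%E.
Proof.
rewrite /L2_norm /Lp_norm unlock /=; congr (_ `^ _)%E.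
rewrite [RHS]integral_mkcond; apply: eq_integral => x _.
rewrite !patchE; case: ifPn => _; last by rewrite abse0 poweR0r // pnatr_eq0.
by rewrite abse_EFin poweR_EFin powR_mulrn // -cabs_sqr real_normK ?num_real.
Qed.

Lemma L2_part c h : L2 h -> sq_integrable (fun x => part c (h x)).
Proof.
case=> mr mi fin.
have mp c' : measurable_fun unit_itv (fun x => part c' (h x)) by case: c'.
split => //; apply/integrableP; split.
  by apply/measurable_EFinP; apply: measurable_funX; exact: mp.
have := fin; rewrite -[Lp_norm _ _]/(L2_norm h) L2_normE.
move=> /lty_poweRy; rewrite invr_eq0 pnatr_eq0 => /(_ isT).
apply: le_lt_trans; apply: ge0_le_integral => //.
- by apply: measurable_unit_itv.
- by do 2 apply: measurableT_comp => //; apply: measurable_funX; exact: mp.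
- apply/measurable_EFinP; apply: measurable_funD; apply: measurable_funX; exact: mp.
- move=> x _; rewrite abse_EFin lee_fin ger0_norm ?sqr_ge0 //.
  by case: c; rewrite ?lerDl ?lerDr sqr_ge0.
Qed.

(** A part of [h], as an element of the real space. *)
Definition l2_part c h : l2 := to_l2 (fun x => part c (h x)).

Lemma l2_partE c h : L2 h -> val (l2_part c h) = (fun x => part c (h x)).
Proof. by move=> h2; apply: to_l2K; exact: L2_part. Qed.

Lemma L2_norm_parts h : (forall c, sq_integrable (fun x => part c (h x))) ->
  L2_norm h = (Num.sqrt (snorm l2_ip (l2_part true h) ^+ 2
                         + snorm l2_ip (l2_part false h) ^+ 2))%:E.
Proof.
move=> hp.
have E c : (\int[mu]_(x in unit_itv) (part c (h x) ^+ 2)%:E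
    = (snorm l2_ip (l2_part c h) ^+ 2)%:E)%E by rewrite sqr_l2_norm to_l2K.
have -> : L2_norm h = ((snorm l2_ip (l2_part true h) ^+ 2
    + snorm l2_ip (l2_part false h) ^+ 2)%:E `^ 2^-1)%E.
  rewrite L2_normE EFinD -!E; congr (_ `^ _)%E.
  under eq_integral do rewrite EFinD.
  by apply: (integralD measurable_unit_itv); [case: (hp true)|case: (hp false)].
by rewrite poweR_EFin powR12_sqrt // addr_ge0 ?sqr_ge0.
Qed.

Lemma L2_of_parts h : (forall c, sq_integrable (fun x => part c (h x))) -> L2 h.
Proof.
move=> hp; split; first by case: (hp true).
  by case: (hp false).
by rewrite -[Lp_norm _ _]/(L2_norm h) L2_norm_parts // ltry.
Qed.

Lemma L2_normP h : L2 h ->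
  L2_norm h = (Num.sqrt (snorm l2_ip (l2_part true h) ^+ 2
                         + snorm l2_ip (l2_part false h) ^+ 2))%:E.
Proof. by move=> h2; apply: L2_norm_parts => c; exact: L2_part. Qed.

Lemma snorm_part_le c h : L2 h -> ((snorm l2_ip (l2_part c h))%:E <= L2_norm h)%E.
Proof.
move=> h2; rewrite L2_normP // lee_fin.
rewrite -(@ler_pXn2r _ 2) ?nnegrE ?sqrtr_ge0 ?snorm_ge0 //.
rewrite [leRHS]sqr_sqrtr ?addr_ge0 ?sqr_ge0 //.
by case: c; rewrite ?lerDl ?lerDr sqr_ge0.
Qed.

Lemma L2_toC (u : @l2 R) : L2 (toC (val u : R -> R)).
Proof. by apply: L2_of_parts => -[]; [exact: l2P|exact: sq_integrable0]. Qed.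

Lemma L2_toC_sq (f : R -> R) : L2 (toC f) -> sq_integrable f.
Proof. exact: (@L2_part true). Qed.

Lemma to_l2_val (v : @l2 R) : to_l2 (val v) = v.
Proof. by apply: val_inj; rewrite to_l2K //; exact: l2P. Qed.

(** A function whose parts are represented in the real space. *)
Lemma L2_repr h (v : bool -> @l2 R) :
  (forall c, (fun x => part c (h x)) = val (v c)) ->
  L2 h /\ forall c, l2_part c h = v c.
Proof.
move=> E; split; last by move=> c; rewrite /l2_part E to_l2_val.
by apply: L2_of_parts => c; rewrite E; exact: l2P.
Qed.

Lemma L2_subZ f g (r : R) : L2 f -> L2 g ->
  L2 (fun x => r%:C * f x - g x) /\
  forall c, l2_part c (fun x => r%:C * f x - g x) = r *: l2_part c f - l2_part c g.
Proof.
move=> hf hg; apply: (@L2_repr _ (fun c => r *: l2_part c f - l2_part c g)) => c.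
have E (p q : @l2 R) : val (r *: p - q) = (fun x => r * val p x - val q x) by [].
by rewrite E !l2_partE //; apply/funext => x; rewrite partB part_realM.
Qed.

Lemma L2_sub f g : L2 f -> L2 g ->
  L2 (fun x => f x - g x) /\
  forall c, l2_part c (fun x => f x - g x) = l2_part c f - l2_part c g.
Proof.
move=> hf hg; have := L2_subZ 1 hf hg.
under eq_fun do rewrite rmorph1 mul1r.
by move=> [? H]; split=> // c; rewrite H scale1r.
Qed.

Lemma part_pairing c f (chi : R -> R) :
  part c (pairing f chi) = \int[mu]_(x in unit_itv) (part c (f x) * chi x).
Proof. by case: c. Qed.

Lemma part_pairing_l2 c f (chi : R -> R) : L2 f -> sq_integrable chi ->
  part c (pairing f chi) = l2_ip (l2_part c f) (to_l2 chi).
Proof. by move=> hf hchi; rewrite part_pairing /l2_ip l2_partE // to_l2K. Qed.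

(** ** Essentially bounded functions *)

Lemma Loo_ae h (M : R) : (Loo_norm h <= M%:E)%E ->
  {ae mu, forall x, unit_itv x -> cabs (h x) <= M}.
Proof.
rewrite /Loo_norm /Lp_norm unlock /=.
have -> : (0 < mu [set: R])%E.
  have := @lebesgue_measure_itv R `]-oo, +oo[%R; rewrite set_itvE /= => ->.
  by rewrite ltry.
move=> /ess_supP; apply: ae_mono => x H xI; move: H.
by rewrite /= patchE mem_set //= lee_fin ger0_norm ?cabs_ge0.
Qed.

Lemma Loo_part_ae c h (M : R) : (Loo_norm h <= M%:E)%E ->
  {ae mu, forall x, unit_itv x -> `|part c (h x)| <= M}.
Proof.
by move=> /Loo_ae; apply: ae_mono => x H /H; apply: le_trans; exact: part_le_cabs.
Qed.

(** ** Convergence *)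

Lemma cvg_le_ereal (I : Type) (F : set_system I) {FF : Filter F} (r : I -> R)
    (N : I -> \bar R) :
  (\forall i \near F, 0 <= r i /\ ((r i)%:E <= N i)%E) ->
  N @ F --> 0%E -> r @ F --> (0 : R).
Proof.
move=> H N0; apply/cvgr0Pnorm_lt => e e0.
have /N0 H2 : nbhs (0%E : \bar R) [set x | (x < e%:E)%E].
  by apply: open_nbhs_nbhs; split; [exact: open_ereal_lt_ereal|rewrite /= lte_fin].
near=> i.
have [r0 rN] : 0 <= r i /\ ((r i)%:E <= N i)%E by near: i.
have : (N i < e%:E)%E by near: i.
by rewrite ger0_norm // -lte_fin; exact: le_lt_trans.
Unshelve. all: by end_near. Qed.

Lemma scvg_part c (I : Type) (F : set_system I) {FF : Filter F}
    (f : I -> R -> R[i]) :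
  (\forall i \near F, L2 (f i)) -> (fun i => L2_norm (f i)) @ F --> 0%E ->
  (fun i => snorm l2_ip (l2_part c (f i))) @ F --> (0 : R).
Proof.
move=> H; apply: cvg_le_ereal; apply: filterS H => i fi.
by split; [exact: snorm_ge0|exact: snorm_part_le].
Qed.

Lemma scvg_part_seq c (f : nat -> R -> R[i]) :
  (forall n, L2 (f n)) -> (fun n => L2_norm (f n)) @ \oo --> 0%E ->
  (fun n => snorm l2_ip (l2_part c (f n))) @ \oo --> (0 : R).
Proof. by move=> H; apply: scvg_part; apply: nearW. Qed.

End Parts.

(** * Expansion in eigenfunctions *)

Section Eigenbasis.
Context (R : realType) (q : R -> R) (lambda : nat -> R) (phi : nat -> R -> R).
Local Open Scope complex_scope.
Hypothesis hphi : SL_eigenbasis q lambda phi.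
Hypothesis hlambda : forall n, 0 < lambda n.
Local Notation ip := (@l2_ip R).
Local Notation hip := (@l2_semi_inner R).

Lemma eigenfunction_sq n : sq_integrable (phi n).
Proof.
case: hphi => /(_ n)[+ _] _ _ => /L2_toC_sq h.
have := sq_integrable_lin (lambda n)^-1 h sq_integrable0.
by under eq_fun do rewrite addr0 mulKf ?gt_eqF //.
Qed.

(** The eigenfunctions in the space of square-integrable functions. *)
Definition eigen n : @l2 R := to_l2 (phi n).

Lemma eigenE n : val (eigen n) = phi n.
Proof. by rewrite to_l2K //; exact: eigenfunction_sq. Qed.

Lemma part_coef c (f : R -> R[i]) n : L2 f ->
  part c (pairing f (phi n)) = ip (l2_part c f) (eigen n).
Proof. by move=> hf; rewrite part_pairing_l2 //; exact: eigenfunction_sq. Qed.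

Lemma eigen_ortho n m : ip (eigen n) (eigen m) = (n == m)%:R.
Proof.
case: hphi => _ /(_ n m) /(congr1 (part true)) + _.
rewrite part_pairing /l2_ip !eigenE => E.
by rewrite [LHS]E; case: (n == m).
Qed.

Lemma l2_sumE n (F : 'I_n -> @l2 R) x :
  val (\sum_(i < n) F i) x = \sum_(i < n) val (F i) x.
Proof. exact: (big_morph (fun u : @l2 R => val u x)). Qed.

(** Subtraction of a finite combination of eigenfunctions. *)
Lemma L2_sub_expansion (g : R -> R[i]) (k : nat -> R[i]) N : L2 g ->
  L2 (fun x => g x - \sum_(n < N) k n * (phi n x)%:C) /\
  forall c, l2_part c (fun x => g x - \sum_(n < N) k n * (phi n x)%:C) =
    l2_part c g - \sum_(n < N) part c (k n) *: eigen n.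
Proof.
move=> hg; apply: (@L2_repr _ _
  (fun c => l2_part c g - \sum_(n < N) part c (k n) *: eigen n)) => c.
apply/funext => x.
have E (p r : @l2 R) : val (p - r) x = val p x - val r x by [].
rewrite E l2_partE // l2_sumE partB part_sum; congr (_ - _).
apply: eq_bigr => i _; rewrite part_mulr.
have Z (a : R) (p : @l2 R) : val (a *: p) x = a * val p x by [].
by rewrite Z eigenE.
Qed.

Lemma eigen_complete v : scvg ip \oo (fun n => proj ip eigen n v) v.
Proof.
case: hphi => _ _ /(_ _ (L2_toC v)) H.
have hv : l2_part true (toC (val v : R -> R)) = v by exact: to_l2_val.
have hp N := L2_sub_expansion
  (fun n => pairing (toC (val v : R -> R)) (phi n)) N (L2_toC v).
have cv : (fun N => snorm ip (l2_part true (fun x => toC (val v) x -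
    \sum_(n < N) pairing (toC (val v : R -> R)) (phi n) * (phi n x)%:C)))
    @ \oo --> (0 : R).
  by apply: scvg_part_seq => // N; case: (hp N).
apply: cvg_trans cv; apply: near_eq_cvg; apply: nearW => N.
have -> : l2_part true (fun x => toC (val v) x -
    \sum_(n < N) pairing (toC (val v : R -> R)) (phi n) * (phi n x)%:C)
    = v - proj ip eigen N v.
  have [_ ->] := hp N; rewrite hv; congr (_ - _).
  by apply: eq_bigr => i _; rewrite part_coef ?hv //; exact: L2_toC.
exact: (snormB hip).
Qed.

(** The eigenfunction coefficients of the elements of W^s. *)
Lemma W_coef (s : R) (f : R -> R[i]) (K : R) c n :
  W q lambda phi s f -> (W_norm lambda phi s f <= K%:E)%E ->
  \sum_(i < n) lambda i `^ s * ip (l2_part c f) (eigen i) ^+ 2 <= K ^+ 2.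
Proof.
move=> [f2 [_ exg]]; rewrite /W_norm /W_dist_norm.
have := xgetPex (fun=> 0) exg; set g := xget _ _ => -[g2 gcv] gK.
have E i : ip (l2_part c g) (eigen i) =
    lambda i `^ (s / 2) * ip (l2_part c f) (eigen i).
  have hp N := L2_sub_expansion
    (fun n => (lambda n `^ (s / 2))%:C * pairing f (phi n)) N g2.
  have cv : (fun N => snorm ip (l2_part c (fun x => g x - \sum_(n < N)
      ((lambda n `^ (s / 2))%:C * pairing f (phi n)) * (phi n x)%:C)))
      @ \oo --> (0 : R).
    by apply: scvg_part_seq => // N; case: (hp N).
  apply/eqP; rewrite -subr_eq0 -normr_le0.
  (* the difference is the i-th coefficient of every remainder with N > i *)
  apply: (cvgr_to_ge cv); exists i.+1 => // N /= iN.
  have -> : ip (l2_part c g) (eigen i)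
      - lambda i `^ (s / 2) * ip (l2_part c f) (eigen i) =
      ip (l2_part c (fun x => g x - \sum_(n < N)
          ((lambda n `^ (s / 2))%:C * pairing f (phi n)) * (phi n x)%:C)) (eigen i).
    have [_ ->] := hp N; rewrite (ipBl hip); congr (_ - _).
    rewrite (ip_suml hip) (bigD1 (Ordinal iN)) //= big1 ?addr0.
      by rewrite (ipZl hip) eigen_ortho eqxx mulr1 part_realM part_coef.
    move=> j ji; rewrite (ipZl hip) eigen_ortho.
    by rewrite (_ : (nat_of_ord j == i) = false) ?mulr0 //; apply/negbTE.
  apply: le_trans (cauchy_schwarz hip _ _) _.
  by rewrite {2}/snorm eigen_ortho eqxx sqrtr1 mulr1.
have K0 : 0 <= K.
  by rewrite -lee_fin; apply: le_trans gK; exact: Lnorm_ge0.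
have gK' : snorm ip (l2_part c g) <= K.
  by rewrite -lee_fin; apply: le_trans gK; exact: snorm_part_le.
apply: (@le_trans _ _ (snorm ip (l2_part c g) ^+ 2)); last first.
  by rewrite ler_pXn2r ?nnegrE ?snorm_ge0.
apply: le_trans (bessel hip eigen_ortho n _).
apply: ler_sum => i _; rewrite E exprMn; apply: ler_wpM2r; first exact: sqr_ge0.
rewrite -powR_mulrn ?powR_ge0 // -powRrM (_ : s / 2 * 2%:R = s) //.
by field.
Qed.

End Eigenbasis.

(** * A positive lower bound for the eigenvalues *)

Section Primitive.
Context {R : realType}.
Local Notation mu := (@lebesgue_measure R).
Local Notation ip := (@l2_ip R).
Local Notation hip := (@l2_semi_inner R).

Lemma unit_itv_measure : mu (@unit_itv R) = 1%E.
Proof. by rewrite /unit_itv lebesgue_measure_itv /= lte_fin ltr01 oppr0 adde0. Qed.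

Lemma bounded_sq_integrable (f : R -> R) (M : R) : measurable_fun unit_itv f ->
  (forall x, unit_itv x -> `|f x| <= M) -> sq_integrable f.
Proof.
move=> mf fM; split => //.
apply: measurable_bounded_integrable.
- exact: measurable_unit_itv.
- by rewrite /= unit_itv_measure ltry.
- exact: measurable_funX.
- exists (M ^+ 2); split; rewrite ?num_real // => y My x /= xI.
  apply: le_trans (ltW My); rewrite normrX.
  have := fM _ xI => H; rewrite ler_pXn2r ?nnegrE //.
  exact: le_trans (normr_ge0 _) H.
Qed.

(** The indicator function of [[0, t]]. *)
Definition ind (t : R) : @l2 R := to_l2 (\1_(`[0, t]%classic : set R)).

Lemma ind_sq t : sq_integrable (\1_(`[0, t]%classic : set R)).
Proof.
apply: (@bounded_sq_integrable _ 1); first exact: measurable_indic.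
by move=> x _; rewrite indicE; case: (_ \in _); rewrite ?normr1 ?normr0.
Qed.

Lemma indE t : val (ind t) = \1_(`[0, t]%classic : set R).
Proof. by rewrite to_l2K //; exact: ind_sq. Qed.

Lemma ind_val (t x : R) : 0 <= x <= t -> val (ind t) x = 1.
Proof. by move=> xt; rewrite indE indicE mem_set //= in_itv. Qed.

Lemma closed_open_itv (t : R) : t <= 1 ->
  `[0, t]%classic `\` [set 0; 1] = (@unit_itv R) `&` `[0, t]%classic.
Proof.
move=> t1; apply/seteqP; split => x /=; rewrite !in_itv /=.
  move=> [/andP[x0 xt] /not_orP[x0' x1]]; split; last by rewrite x0.
  rewrite /unit_itv /= in_itv /= !lt_neqAle x0 (le_trans xt t1) !andbT eq_sym.
  by apply/andP; split; apply/eqP.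
rewrite /unit_itv /= in_itv /= => -[/andP[x0 x1] /andP[_ xt]].
split; first by rewrite xt ltW.
by case=> E; move: x0 x1; rewrite E ltxx.
Qed.

Lemma endpoints_negligible : mu [set 0; 1] = 0%E.
Proof.
apply: countable_lebesgue_measure0; apply: finite_set_countable.
exact: finite_set2.
Qed.

Lemma integrable_closed (f : R -> R) : sq_integrable f ->
  mu.-integrable `[0, 1] (EFin \o f).
Proof.
move=> hf; have [mf _] := hf.
have one : sq_integrable (fun=> 1 : R).
  apply: (@bounded_sq_integrable _ 1); first exact: measurable_cst.
  by move=> x _; rewrite normr1.
have mN : measurable ([set 0; 1] : set (measurableTypeR R)).
  by apply: measurableU; exact: measurable_set1.
have mD : measurable (`[0, 1]%classic : set (measurableTypeR R)).
  exact: measurable_itv.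
have mfD : measurable_fun (`[0, 1]%classic : set (measurableTypeR R)) (EFin \o f).
  by apply/measurable_EFinP; exact: measurable_fun_itv_cc mf.
have [_] := @negligible_integrable _ _ _ mu _ _ _ mN mD mfD endpoints_negligible.
apply.
rewrite closed_open_itv // (_ : _ `&` _ = @unit_itv R).
  apply: eq_integrable (integrable_mul hf one) => //.
    exact: measurable_unit_itv.
  by move=> x _ /=; rewrite mulr1.
by apply/setIidPl => x /=; rewrite !in_itv /= => /andP[/ltW -> /ltW ->].
Qed.

(** Integration over [[0, t]] is the inner product with the indicator. *)
Lemma primitive_ip (f : R -> R) t : sq_integrable f -> 0 <= t <= 1 ->
  \int[mu]_(x in `[0, t]) f x = ip (ind t) (to_l2 f).
Proof.
move=> hf /andP[t0 t1].
have sub : (`[0, t]%classic : set R) `<=` `[0, 1]%classic.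
  by move=> x /=; rewrite !in_itv /= => /andP[-> xt]; exact: le_trans xt t1.
transitivity (\int[mu]_(x in (@unit_itv R) `&` `[0, t]%classic) f x).
  rewrite -closed_open_itv //; congr fine.
  apply: negligible_integral => //.
  - by apply: measurableU; exact: measurable_set1.
  - exact: integrableS (integrable_closed hf).
  - exact: endpoints_negligible.
rewrite Rintegral_mkcondr; apply: eq_Rintegral => x _.
by rewrite indE to_l2K // patchE indicE; case: (x \in _); rewrite ?mul1r ?mul0r.
Qed.

Lemma snorm_ind_le t : snorm ip (ind t) <= 1.
Proof.
rewrite -(@ler_pXn2r _ 2) ?nnegrE ?snorm_ge0 // expr1n -lee_fin sqr_l2_norm indE.
rewrite -unit_itv_measure -[leRHS]mul1e -integral_cst;
  last exact: measurable_unit_itv.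
apply: ge0_le_integral => //.
- exact: measurable_unit_itv.
- by apply/measurable_EFinP; apply: measurable_funX; exact: measurable_indic.
- move=> x _; rewrite lee_fin indicE.
  by case: (_ \in _); rewrite ?expr1n ?expr0n.
Qed.

(** The primitive of [u] vanishing at 0. *)
Definition prim (u : @l2 R) (t : R) : R := ip (ind t) u.

Lemma prim_sq u : sq_integrable (prim u).
Proof.
have H t : 0 <= t <= 1 -> prim u t = \int[mu]_(x in `[0, t]) val u x.
  by move=> t01; rewrite primitive_ip ?to_l2_val //; exact: l2P.
apply: (@bounded_sq_integrable _ (snorm ip u)).
  suff : measurable_fun unit_itv (fun t => \int[mu]_(x in `[0, t]) val u x).
    apply: eq_measurable_fun => t; rewrite inE /unit_itv /= in_itv /=.
    by move=> /andP[/ltW t0 /ltW t1]; rewrite H ?t0.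
  have c := parameterized_integral_continuous ler01 (integrable_closed (l2P u)).
  have mc : measurable_fun (`[0, 1]%classic : set R)
      (fun t => \int[mu]_(x in `[0, t]) val u x).
    by apply: subspace_continuous_measurable_fun c.
  apply: measurable_funS mc => //.
  by move=> x; rewrite /unit_itv /= !in_itv /= => /andP[/ltW -> /ltW ->].
move=> t _; apply: le_trans (cauchy_schwarz hip _ _) _.
by rewrite -[leRHS]mul1r ler_wpM2r ?snorm_ge0 ?snorm_ind_le.
Qed.

(** A function on [[0, 1]] that vanishes at both endpoints and whose second
    derivative is [y2] is bounded by twice the norm of the primitive of [y2]. *)
Lemma dirichlet_bound (y y1 y2 : R -> R) : sq_integrable y2 ->
  (forall x : R, 0 <= x <= 1 -> y x = y 0 + \int[mu]_(t in `[0, x]) y1 t) ->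
  (forall x : R, 0 <= x <= 1 -> y1 x = y1 0 + \int[mu]_(t in `[0, x]) y2 t) ->
  y 0 = 0 -> y 1 = 0 ->
  sq_integrable y /\
  snorm ip (to_l2 y) <= 2 * snorm ip (to_l2 (prim (to_l2 y2))).
Proof.
move=> h2 Hy Hy1 y0 y10.
set g := to_l2 (prim (to_l2 y2)).
(* Y represents y', so that y x is the inner product of Y with [ind x] *)
pose Y := y1 0 *: ind 1 + g.
have YE x : 0 <= x <= 1 -> val Y x = y1 x.
  move=> x01; have E : val Y x = y1 0 * val (ind 1) x + val g x by [].
  rewrite E ind_val // to_l2K; last exact: prim_sq.
  by rewrite mulr1 [RHS]Hy1 // primitive_ip.
have yE x : 0 <= x <= 1 -> y x = ip (ind x) Y.
  move=> x01; rewrite Hy // y0 add0r -[Y]to_l2_val -primitive_ip //; last exact: l2P.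
  apply: eq_Rintegral => t; rewrite inE /= in_itv /= => /andP[t0 tx].
  by rewrite -YE // t0 (le_trans tx) //; case/andP: x01.
have one x : 0 <= x <= 1 -> ip (ind x) (ind 1) = x.
  move=> x01; rewrite -primitive_ip //; last exact: ind_sq.
  rewrite -[RHS]mul1r -[in RHS](subr0 x).
  transitivity (\int[mu]_(t in `[0, x]) (1 : R)).
    apply: eq_Rintegral => t; rewrite inE /= in_itv /= => /andP[t0 tx].
    have := @ind_val 1 t; rewrite indE => -> //.
    by rewrite t0 (le_trans tx) //; case/andP: x01.
  rewrite Rintegral_cst //= lebesgue_measure_itv /= lte_fin.
  case/andP: x01; rewrite le_eqVlt => /predU1P[<-|->] _ //.
  by rewrite ltxx /= subrr mulr0.
have e1 : 0 <= (1 : R) <= 1 by rewrite ler01 lexx.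
have y1E : y1 0 = - ip (ind 1) g.
  have := yE 1 e1; rewrite y10 (ipDr hip) (ipZr hip) one // mulr1.
  by move=> /eqP; rewrite eq_sym addr_eq0 => /eqP.
(* the condition at 1 eliminates y'(0) *)
have bnd x : 0 <= x <= 1 -> `|y x| <= 2 * snorm ip g.
  move=> x01; have -> : y x = ip (ind x - x *: ind 1) g.
    rewrite yE // (ipDr hip) (ipZr hip) one // y1E (ipBl hip) (ipZl hip); ring.
  apply: le_trans (cauchy_schwarz hip _ _) _.
  rewrite ler_wpM2r ?snorm_ge0 //; apply: le_trans (ler_snormD hip _ _) _.
  rewrite (snormN hip) (snormZ hip) (_ : 2 = 1 + 1 * 1); last by ring.
  rewrite lerD ?snorm_ind_le // ler_pM ?snorm_ge0 ?snorm_ind_le //.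
  by case/andP: x01 => x0 x1; rewrite ger0_norm.
have sy : sq_integrable y.
  apply: (@bounded_sq_integrable _ (2 * snorm ip g)); last first.
    move=> x; rewrite /unit_itv /= in_itv /= => /andP[/ltW x0 /ltW x1].
    by rewrite bnd ?x0.
  have [+ _] := prim_sq Y; apply: eq_measurable_fun => t.
  by rewrite inE /unit_itv /= in_itv /= => /andP[/ltW t0 /ltW t1]; rewrite yE ?t0.
split => //.
rewrite -(@ler_pXn2r _ 2) ?nnegrE ?mulr_ge0 ?snorm_ge0 //.
rewrite -lee_fin sqr_l2_norm to_l2K //.
rewrite -[leRHS]mule1 -unit_itv_measure -integral_cst;
  last exact: measurable_unit_itv.
apply: ge0_le_integral => //.
- exact: measurable_unit_itv.
- by move=> x _; rewrite lee_fin sqr_ge0.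
- by apply/measurable_EFinP; apply: measurable_funX; case: sy.
- move=> x; rewrite /unit_itv /= in_itv /= => /andP[/ltW x0 /ltW x1].
  rewrite lee_fin -[y x ^+ 2]real_normK ?num_real //.
  rewrite ler_pXn2r ?nnegrE ?mulr_ge0 ?snorm_ge0 //.
  by rewrite bnd ?x0.
Qed.

End Primitive.

Section SpectralBound.
Context (R : realType) (q : R -> R) (lambda : nat -> R) (phi : nat -> R -> R).
Hypothesis hq : Loo (toC q).
Hypothesis hphi : SL_eigenbasis q lambda phi.
Hypothesis hlambda : forall n, 0 < lambda n.
Local Notation mu := (@lebesgue_measure R).
Local Notation ip := (@l2_ip R).
Local Notation hip := (@l2_semi_inner R).
Local Notation e := (eigen phi).

Let ortho := eigen_ortho hphi hlambda.

(** Bessel's inequality for the indicators, integrated over their endpoint. *)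
Lemma sum_sqr_prim_le (m : @l2 R -> @l2 R) (M : R) n : 0 <= M ->
  (forall u v, ip (m u) v = ip u (m v)) ->
  (forall u, snorm ip (m u) <= M * snorm ip u) ->
  \sum_(i < n) snorm ip (to_l2 (prim (m (e i)))) ^+ 2 <= M ^+ 2.
Proof.
move=> M0 msym mM; rewrite -lee_fin -sumEFin.
rewrite (eq_bigr (fun i : 'I_n =>
    (\int[mu]_(t in unit_itv) (prim (m (e i)) t ^+ 2)%:E)%E)); last first.
  by move=> i _; rewrite sqr_l2_norm to_l2K //; exact: prim_sq.
rewrite -ge0_integral_sum; first last.
- by move=> i x _; rewrite lee_fin sqr_ge0.
- move=> i; apply/measurable_EFinP; apply: measurable_funX.
  by case: (prim_sq (m (e i))).
- exact: measurable_unit_itv.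
rewrite -[leRHS]mule1 -unit_itv_measure -integral_cst;
  last exact: measurable_unit_itv.
apply: ge0_le_integral => //.
- exact: measurable_unit_itv.
- by move=> x _; apply: sume_ge0 => i _; rewrite lee_fin sqr_ge0.
- apply: emeasurable_sum => i; apply/measurable_EFinP; apply: measurable_funX.
  by case: (prim_sq (m (e i))).
- move=> t _; rewrite sumEFin lee_fin.
  apply: (@le_trans _ _ (snorm ip (m (ind t)) ^+ 2)).
    apply: le_trans (bessel hip ortho n _); apply: ler_sum => i _.
    by rewrite /prim msym.
  rewrite ler_pXn2r ?nnegrE ?snorm_ge0 //; apply: le_trans (mM _) _.
  by rewrite -[leRHS]mulr1 ler_wpM2l // snorm_ind_le.
Qed.

Let Q := fine (Loo_norm (toC q)).

Let Loo_normQ : (Loo_norm (toC q) <= Q%:E)%E.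
Proof.
case: hq => _ _ fin; rewrite /Q fineK // ge0_fin_numE //.
exact: Lnorm_ge0.
Qed.

Let Q0 : 0 <= Q. Proof. by rewrite fine_ge0 // Lnorm_ge0. Qed.

Let mq : measurable_fun unit_itv q. Proof. by case: hq. Qed.

Let qQ : {ae mu, forall x, unit_itv x -> `|q x| <= Q}.
Proof. exact: (Loo_part_ae true Loo_normQ). Qed.

Let qmul := l2_mul q.

(** The norms of the two primitives that make up that of the second derivative
    of an eigenfunction; an eigenvalue at most 1 forces them to be large. *)
Let weight n := snorm ip (to_l2 (prim (qmul (e n)))) ^+ 2
  + snorm ip (to_l2 (prim (e n))) ^+ 2.

Let weight_ge n : lambda n <= 1 -> 1 <= 8 * weight n.
Proof.
have alg (p r : R) :
    1 <= (2 * (p + r)) ^+ 2 -> 0 <= (p - r) ^+ 2 -> 1 <= 8 * (p ^+ 2 + r ^+ 2).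
  by rewrite exprMn sqrrB sqrrD; lra.
move=> l1; case: (hphi) => /(_ n)[_ [y1 [y2 [+ Hy Hy1 [y0 y10] yae]]]] _ _.
move=> /L2_toC_sq h2.
have [_] := dirichlet_bound h2 Hy Hy1 y0 y10.
have -> : snorm ip (to_l2 (phi n)) = 1.
  by rewrite /snorm -/(e n) ortho eqxx sqrtr1.
set g := to_l2 (prim (to_l2 y2)).
set A := to_l2 (prim (qmul (e n))); set B := to_l2 (prim (e n)).
have -> : g = A - lambda n *: B.
  apply: val_inj; rewrite to_l2K; last exact: prim_sq.
  apply/funext => t; rewrite /prim.
  have E : val (A - lambda n *: B) t = val A t - lambda n * val B t by [].
  rewrite E !to_l2K; try exact: prim_sq.
  rewrite /prim !(ipC hip (ind t)) -(ipZl hip) -(ipBl hip).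
  apply: l2_ip_ae; apply: ae_mono yae => x H xI; have {}H := H xI.
  have E' : val (qmul (e n) - lambda n *: e n) x
    = val (qmul (e n)) x - lambda n * val (e n) x by [].
  rewrite E' (l2_mulE mq Q0 qQ) to_l2K // (eigenE hphi hlambda) H; ring.
move=> H.
have l0 := ltW (hlambda n).
have : snorm ip (A - lambda n *: B) <= snorm ip A + snorm ip B.
  apply: le_trans (ler_snormD hip _ _) _; rewrite (snormN hip) (snormZ hip) lerD2l.
  by rewrite ger0_norm // -[leRHS]mul1r ler_wpM2r // snorm_ge0.
rewrite /weight -/A -/B => H'; apply: alg; last exact: sqr_ge0.
rewrite -{1}(expr1n R 2) ler_pXn2r ?nnegrE ?mulr_ge0 ?addr_ge0 ?snorm_ge0 //.
by apply: le_trans H _; rewrite ler_wpM2l.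
Qed.

Let sum_weight_le n : \sum_(i < n) weight i <= Q ^+ 2 + 1.
Proof.
rewrite big_split lerD //.
  apply: sum_sqr_prim_le; first exact: Q0.
    exact: (l2_mul_sym mq Q0 qQ).
  exact: (l2_mul_norm mq Q0 qQ).
rewrite -(expr1n R 2); apply: (@sum_sqr_prim_le id) => // u.
by rewrite mul1r.
Qed.

Let weight_cvg0 : weight @ \oo --> (0 : R).
Proof.
apply: cvg_series_cvg_0; apply: nondecreasing_is_cvgn.
  apply: nondecreasing_series => n _ _.
  by rewrite addr_ge0 ?sqr_ge0.
exists (Q ^+ 2 + 1) => _ [n _ <-].
by rewrite /series /= big_mkord; exact: sum_weight_le.
Qed.

Lemma eigenvalue_lower_bound : exists2 c : R, 0 < c & forall n, c <= lambda n.
Proof.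
have [N _ HN] : \forall n \near \oo, 1 < lambda n.
  have : \forall n \near \oo, `|weight n| < 8^-1.
    by apply: cvgr0_norm_lt => //; rewrite invr_gt0.
  apply: filterS => n; rewrite ger0_norm ?addr_ge0 ?sqr_ge0 // => H.
  rewrite ltNge; apply/negP => /weight_ge; rewrite leNgt => /negP; apply.
  by rewrite -ltr_pdivlMl // mulr1.
have [c c0 Hc] : exists2 c : R, 0 < c & forall n, (n < N)%N -> c <= lambda n.
  elim: N {HN} => [|N [c c0 Hc]]; first by exists 1.
  exists (Num.min c (lambda N)); first by rewrite lt_min c0 hlambda.
  move=> n; rewrite ltnS leq_eqVlt => /predU1P[->|nN]; rewrite ge_min.
    by rewrite lexx orbT.
  by rewrite Hc.
exists (Num.min c 1); first by rewrite lt_min c0 ltr01.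
move=> n; rewrite ge_min; have [nN|Nn] := ltnP n N; first by rewrite Hc.
by rewrite orbC ltW //; exact: HN.
Qed.

End SpectralBound.

(** * Solutions of the wave equation, part by part *)

Section Wave.
Context (R : realType) (T s : R) (q : R -> R) (lambda : nat -> R)
  (phi : nat -> R -> R).
Local Open Scope complex_scope.
Hypothesis T_gt0 : 0 < T.
Hypothesis hphi : SL_eigenbasis q lambda phi.
Hypothesis hlambda : forall n, 0 < lambda n.
Local Notation ip := (@l2_ip R).
Local Notation hip := (@l2_semi_inner R).
Local Notation e := (eigen phi).

#[local] Instance time_filter t : Filter (time_nbhs T t).
Proof. exact: time_nbhs_filter. Qed.

Lemma scalar_derivative_part c (f g : R -> R[i]) : scalar_derivative T f g ->
  forall t : R, 0 <= t <= T -> tderiv T (fun t => part c (f t)) t (part c (g t)).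
Proof.
move=> fg t /fg H; apply/subr_cvg0/norm_cvg0P.
apply: squeeze_cvgr H; last exact: cvg_cst.
apply: nearW => t'; rewrite normr_ge0 /=.
rewrite -partB -part_realM -partB; exact: part_le_cabs.
Qed.

Lemma tderiv_eq (g h : R -> R) (t l : R) : 0 <= t <= T ->
  (forall t', 0 <= t' <= T -> g t' = h t') -> tderiv T g t l -> tderiv T h t l.
Proof.
move=> tT gh; apply: cvg_trans; apply: near_eq_cvg.
apply: filterS (time_nbhs_in T t) => t' [t'T _].
by rewrite !gh.
Qed.

Lemma continuous_part c (u : R -> R -> R[i]) :
  continuous_in_time (@L2 R) (@L2_norm R) T u ->
  forall t : R, 0 <= t <= T ->
    scvg ip (time_nbhs T t) (fun t => l2_part c (u t)) (l2_part c (u t)).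
Proof.
move=> cu t tT; have [ut H] := cu t tT.
have near2 : \forall t' \near time_nbhs T t, L2 (fun x => u t' x - u t x) /\
    l2_part c (fun x => u t' x - u t x) = l2_part c (u t') - l2_part c (u t).
  apply: filterS (time_nbhs_in T t) => t' [t'T _].
  by have [h1 h2] := L2_sub (cu t' t'T).1 ut.
have cv : (fun t' => snorm ip (l2_part c (fun x => u t' x - u t x)))
    @ time_nbhs T t --> (0 : R).
  by apply: scvg_part H; apply: filterS near2 => t' [].
apply: cvg_trans cv; apply: near_eq_cvg.
by apply: filterS near2 => t' [_ ->].
Qed.

Lemma derivative_part c (u v : R -> R -> R[i]) :
  (forall t : R, 0 <= t <= T -> L2 (u t)) ->
  (forall t : R, 0 <= t <= T -> L2 (v t)) ->
  derivative_in_time (@L2_norm R) T u v ->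
  forall t : R, 0 <= t <= T ->
    vderiv T ip (fun t => l2_part c (u t)) t (l2_part c (v t)).
Proof.
move=> u2 v2 du t tT; have H := du t tT.
have near2 : \forall t' \near time_nbhs T t,
    L2 (fun x => ((t' - t)^-1)%:C * (u t' x - u t x) - v t x) /\
    l2_part c (fun x => ((t' - t)^-1)%:C * (u t' x - u t x) - v t x) =
      (t' - t)^-1 *: (l2_part c (u t') - l2_part c (u t)) - l2_part c (v t).
  apply: filterS (time_nbhs_in T t) => t' [t'T _].
  have [h1 h2] := L2_sub (u2 t' t'T) (u2 t tT).
  have [h3 h4] := L2_subZ (t' - t)^-1 h1 (v2 t tT).
  by split => //; rewrite h4 h2.
have cv : (fun t' => snorm ip (l2_part c
    (fun x => ((t' - t)^-1)%:C * (u t' x - u t x) - v t x)))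
    @ time_nbhs T t --> (0 : R).
  by apply: scvg_part H; apply: filterS near2 => t' [].
apply: cvg_trans cv; apply: near_eq_cvg.
by apply: filterS near2 => t' [_ ->].
Qed.

Lemma complex_ge0 (z : R[i]) : 0 <= z -> complex.Im z = 0 /\ 0 <= complex.Re z.
Proof. by rewrite lecE /= => /andP[/eqP]. Qed.

(** An equation with real coefficients splits into equations for the real and
    the imaginary part; their coefficients on the eigenfunctions satisfy the
    ordinary differential equations below. *)
Lemma wave_solution_part (a b u0 u1 : R -> R[i]) (u : R -> R -> R[i]) (Ma Mb : R) :
  (forall x, unit_itv x -> 0 <= a x) -> (forall x, unit_itv x -> 0 <= b x) ->
  Loo a -> Loo b -> 0 <= Ma -> 0 <= Mb ->
  (Loo_norm a <= Ma%:E)%E -> (Loo_norm b <= Mb%:E)%E -> L2 u0 -> L2 u1 ->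
  wave_solution q lambda phi T s a b u0 u1 u ->
  exists v : R -> R -> R[i],
    (forall t : R, 0 <= t <= T -> L2 (u t) /\ L2 (v t)) /\
    forall c,
    [/\ forall t : R, 0 <= t <= T ->
          vderiv T ip (fun t => l2_part c (u t)) t (l2_part c (v t)),
        forall t : R, 0 <= t <= T ->
          scvg ip (time_nbhs T t) (fun t => l2_part c (v t)) (l2_part c (v t)),
        forall n (t : R), 0 <= t <= T ->
          tderiv T (fun t => ip (l2_part c (v t)) (e n)) t
            (- (lambda n `^ s * ip (l2_part c (u t)) (e n)
                + ip (l2_mul (part true \o a) (l2_part c (u t))
                      + l2_mul (part true \o b) (l2_part c (v t))) (e n))),
        forall n, ip (l2_part c (u 0)) (e n) = ip (l2_part c u0) (e n) &
        forall n, ip (l2_part c (v 0)) (e n) = ip (l2_part c u1) (e n)].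
Proof.
move=> a0 b0 aoo boo Ma0 Mb0 aM bM u02 u12 [_ [v [cu du cv eqn]]].
have u2 t : 0 <= t <= T -> L2 (u t) by move=> /cu[].
have v2 t : 0 <= t <= T -> L2 (v t) by move=> /cv[].
have T0 : 0 <= (0 : R) <= T by rewrite lexx ltW.
exists v; split; first by move=> t tT; split; [exact: u2|exact: v2].
move=> c.
have coef f n : L2 f -> part c (pairing f (phi n)) = ip (l2_part c f) (e n).
  exact: (part_coef hphi hlambda).
have vd := derivative_part c u2 v2 du.
(* the derivative of the coefficient of u is the coefficient of v *)
have dv n d : scalar_derivative T (fun t => pairing (u t) (phi n)) d ->
    forall t : R, 0 <= t <= T -> part c (d t) = ip (l2_part c (v t)) (e n).
  move=> Hd t tT; have H1 := @scalar_derivative_part c _ _ Hd t tT.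
  have H2 : tderiv T (fun t => part c (pairing (u t) (phi n))) t
      (ip (l2_part c (v t)) (e n)).
    have H0 : tderiv T (fun t => ip (l2_part c (u t)) (e n)) t
        (ip (l2_part c (v t)) (e n)) by apply: (tderiv_ip hip); exact: vd.
    apply: (tderiv_eq tT _ H0) => t' t'T.
    by rewrite coef //; exact: u2.
  exact: (tderiv_unique T_gt0 tT H1 H2).
split.
- exact: vd.
- exact: continuous_part.
- move=> n t tT; have [d [d2 [Hd Hd2 E _ _]]] := eqn n.
  have -> : - (lambda n `^ s * ip (l2_part c (u t)) (e n)
      + ip (l2_mul (part true \o a) (l2_part c (u t))
            + l2_mul (part true \o b) (l2_part c (v t))) (e n)) = part c (d2 t).
    have := congr1 (part c) (E t tT); rewrite !partD part_realM coef; last exact: u2.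
    have -> : part c (0 : R[i]) = 0 by case: (c).
    suff -> : part c (pairing (fun x => a x * u t x + b x * v t x) (phi n)) =
       ip (l2_mul (part true \o a) (l2_part c (u t))
            + l2_mul (part true \o b) (l2_part c (v t))) (e n) by lra.
    rewrite part_pairing; apply: eq_Rintegral => x; rewrite inE => xI.
    rewrite (eigenE hphi hlambda); congr (_ * _).
    have E' (p r : @l2 R) : val (p + r) x = val p x + val r x by [].
    have [ma _ _] := aoo; have [mb _ _] := boo.
    rewrite E' (l2_mulE ma Ma0 (Loo_part_ae true aM)).
    rewrite (l2_mulE mb Mb0 (Loo_part_ae true bM)).
    rewrite !l2_partE; [|exact: v2|exact: u2].
    have [a1 _] := complex_ge0 (a0 x xI); have [b1 _] := complex_ge0 (b0 x xI).
    by rewrite partD !partM.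
  apply: (tderiv_eq tT _ (@scalar_derivative_part c _ _ Hd2 t tT)) => t' t'T.
  exact: dv.
- move=> n; have [d [d2 [_ _ _ E _]]] := eqn n.
  by rewrite -!coef ?E //; exact: u2.
- move=> n; have [d [d2 [Hd _ _ _ E]]] := eqn n.
  by rewrite -(dv n d Hd 0 T0) E coef.
Qed.

End Wave.

(** * Comparison of two solutions *)

Section Comparison.
Context (R : realType) (T s : R) (q : R -> R) (lambda : nat -> R)
  (phi : nat -> R -> R).
Hypothesis T_gt0 : 0 < T.
Hypothesis hphi : SL_eigenbasis q lambda phi.
Hypothesis hlambda : forall n, 0 < lambda n.
Variable c0 : R.
Hypothesis c0_gt0 : 0 < c0.
Hypothesis c0_le : forall n, c0 <= lambda n `^ s.
Local Notation ip := (@l2_ip R).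
Local Notation hip := (@l2_semi_inner R).
Local Notation e := (eigen phi).
Let ortho := eigen_ortho hphi hlambda.
Let complete := eigen_complete hphi hlambda.

Lemma l2_mul_part_sub (a a' : R -> R[i]) (A A' D : R) v :
  Loo a -> Loo a' -> Loo (fun x => a x - a' x) -> 0 <= A -> 0 <= A' -> 0 <= D ->
  (Loo_norm a <= A%:E)%E -> (Loo_norm a' <= A'%:E)%E ->
  (Loo_norm (fun x => a x - a' x)%R <= D%:E)%E ->
  l2_mul (part true \o (fun x => a x - a' x)) v =
    l2_mul (part true \o a) v - l2_mul (part true \o a') v.
Proof.
move=> [ma _ _] [ma' _ _] [md _ _] A0 A0' D0 aA aA' aD.
apply: val_inj; apply/funext => x.
have E (p r : @l2 R) : val (p - r) x = val p x - val r x by [].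
rewrite E (l2_mulE ma A0 (Loo_part_ae true aA)).
rewrite (l2_mulE ma' A0' (Loo_part_ae true aA')).
rewrite (l2_mulE md D0 (Loo_part_ae true aD)) -mulrBl; congr (_ * _).
exact: (partB true (a x) (a' x)).
Qed.

(** The bound of [energy_data_estimate] on the squared norm of the velocity,
    without a source: [m0] and [m1] bound the initial data in W^s and L^2, and
    [A] the coefficient of the zeroth order term. *)
Definition velocity_bound (A m0 m1 : R) : R :=
  2 * (m1 ^+ 2 + m0 ^+ 2 + A * (c0^-1 * m0 ^+ 2)).

(** The corresponding bound on the squared norm of the solution itself. *)
Definition position_bound (A m0 m1 : R) : R :=
  2 * (c0^-1 * m0 ^+ 2) + 2 * T ^+ 2 * velocity_bound A m0 m1.

Section TwoSolutions.
Variables (a a' b b' u0 u0' u1 u1' : R -> R[i]) (u u' : R -> R -> R[i]).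
Variables (A A' B B' Da Db m0 m1 k0 k1 : R).
Hypothesis (a0 : forall x, unit_itv x -> 0 <= a x).
Hypothesis (a0' : forall x, unit_itv x -> 0 <= a' x).
Hypothesis (b0 : forall x, unit_itv x -> 0 <= b x).
Hypothesis (b0' : forall x, unit_itv x -> 0 <= b' x).
Hypothesis (aoo : Loo a) (aoo' : Loo a') (boo : Loo b) (boo' : Loo b').
Hypothesis (doo : Loo (fun x => a x - a' x)) (eoo : Loo (fun x => b x - b' x)).
Hypothesis (A0 : 0 <= A) (A0' : 0 <= A') (B0 : 0 <= B) (B0' : 0 <= B')
  (Da0 : 0 <= Da) (Db0 : 0 <= Db).
Hypothesis (aA : (Loo_norm a <= A%:E)%E) (aA' : (Loo_norm a' <= A'%:E)%E).
Hypothesis (bB : (Loo_norm b <= B%:E)%E) (bB' : (Loo_norm b' <= B'%:E)%E).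
Hypothesis dD : (Loo_norm (fun x => a x - a' x)%R <= Da%:E)%E.
Hypothesis eD : (Loo_norm (fun x => b x - b' x)%R <= Db%:E)%E.
Hypothesis (w0 : W q lambda phi s u0) (w0' : W q lambda phi s u0').
Hypothesis w0d : W q lambda phi s (fun x => u0 x - u0' x).
Hypothesis (h1 : L2 u1) (h1' : L2 u1').
Hypothesis m0P : (W_norm lambda phi s u0' <= m0%:E)%E.
Hypothesis m1P : (L2_norm u1' <= m1%:E)%E.
Hypothesis k0P : (W_norm lambda phi s (fun x => u0 x - u0' x)%R <= k0%:E)%E.
Hypothesis k1P : (L2_norm (fun x => u1 x - u1' x)%R <= k1%:E)%E.
Hypothesis (sol : wave_solution q lambda phi T s a b u0 u1 u).
Hypothesis (sol' : wave_solution q lambda phi T s a' b' u0' u1' u').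

(** Equality of coefficients is all that is known of the initial velocity; by
    Parseval it determines the norm. *)
Let snorm_coef_le (v : @l2 R) (f : R -> R[i]) (k : R) c : L2 f ->
  (L2_norm f <= k%:E)%E ->
  (forall n, ip v (e n) = ip (l2_part c f) (e n)) -> snorm ip v <= k.
Proof.
move=> hf fk E.
have fk' : snorm ip (l2_part c f) <= k.
  by rewrite -lee_fin; apply: le_trans fk; exact: snorm_part_le.
apply: le_trans fk'.
rewrite -(@ler_pXn2r _ 2) ?nnegrE ?snorm_ge0 //.
have := @parseval_le _ _ _ hip e complete 1 (snorm ip (l2_part c f) ^+ 2)
  (fun=> 1) v ltr01 (fun=> lexx _).
rewrite invr1 mul1r; apply => n.
under eq_bigr do rewrite mul1r E.
exact: (bessel hip ortho).
Qed.

(** The second solution is bounded by its data; the difference solves the first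
    equation with a source that involves the differences of the coefficients and
    the second solution. *)
Lemma difference_bound (F t : R) c : 0 <= t <= T ->
  Da * Num.sqrt (position_bound A' m0 m1)
    + Db * Num.sqrt (velocity_bound A' m0 m1) <= F ->
  L2 (fun x => u t x - u' t x) /\
  snorm ip (l2_part c (fun x => u t x - u' t x)) ^+ 2 <=
    2 * (c0^-1 * k0 ^+ 2)
    + 2 * T ^+ 2 * (velocity_bound A k0 k1 + 4 * T ^+ 2 * F ^+ 2).
Proof.
move=> tT HF.
have [v [uv2 /(_ c)[du cv eqn ic0 ic1]]] := wave_solution_part T_gt0 hphi hlambda
  a0 b0 aoo boo A0 B0 aA bB w0.1 h1 sol.
have [v' [uv2' /(_ c)[du' cv' eqn' ic0' ic1']]] := wave_solution_part T_gt0 hphi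
  hlambda a0' b0' aoo' boo' A0' B0' aA' bB' w0'.1 h1' sol'.
have [L2d Ed] := L2_sub (uv2 t tT).1 (uv2' t tT).1.
split; first exact: L2d.
have mu0 n : 0 <= lambda n `^ s by exact: powR_ge0.
have pos (f : R -> R[i]) x : (forall x, unit_itv x -> 0 <= f x) -> unit_itv x ->
    0 <= (part true \o f) x.
  by move=> f0 /f0 /complex_ge0[].
have [[ma _ _] [mb _ _]] := (aoo, boo).
have [[ma' _ _] [mb' _ _]] := (aoo', boo').
have [[md _ _] [me _ _]] := (doo, eoo).
have aAe := Loo_part_ae true aA; have bBe := Loo_part_ae true bB.
have aAe' := Loo_part_ae true aA'; have bBe' := Loo_part_ae true bB'.
have dDe := Loo_part_ae true dD; have eDe := Loo_part_ae true eD.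
pose U r := l2_part c (u r); pose V r := l2_part c (v r).
pose U' r := l2_part c (u' r); pose V' r := l2_part c (v' r).
pose mA := l2_mul (part true \o a); pose mB := l2_mul (part true \o b).
pose mA' := l2_mul (part true \o a'); pose mB' := l2_mul (part true \o b').
(* the reference solution *)
have bound' r : 0 <= r <= T -> snorm ip (V' r) ^+ 2 <= velocity_bound A' m0 m1 /\
    snorm ip (U' r) ^+ 2 <= position_bound A' m0 m1.
  move=> rT.
  have := @energy_data_estimate R T _ ip T_gt0 hip e (fun n => lambda n `^ s)
    ortho complete mu0 mA' mB' A' B'
    (l2_mulB ma' A0' aAe') (l2_mul_sym ma' A0' aAe')
    (fun w => l2_mul_ge0 ma' A0' aAe' w (fun x => pos a' x a0'))
    (l2_mul_norm ma' A0' aAe')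
    (fun w => l2_mul_ge0 mb' B0' bBe' w (fun x => pos b' x b0'))
    (l2_mul_norm mb' B0' bBe')
    U' V' (fun=> 0) 0 (m0 ^+ 2) du' cv'.
  move=> H; have := H _ _ _ c0 m1 r c0_gt0 c0_le A0' _ rT.
  rewrite /= expr0n mulr0 addr0; apply.
  - by move=> n r' rT'; rewrite subr0; exact: eqn'.
  - by move=> r' _; rewrite (snorm0 hip).
  - move=> n; under eq_bigr do rewrite ic0'.
    exact: (W_coef hphi hlambda c n w0' m0P).
  - exact: (snorm_coef_le h1' m1P ic1').
(* the difference solves the equation with the source f *)
pose f r := - (l2_mul (part true \o (fun x => a x - a' x)) (U' r)
  + l2_mul (part true \o (fun x => b x - b' x)) (V' r)).
have fF r : 0 <= r <= T -> snorm ip (f r) <= F.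
  move=> rT; apply: le_trans HF; rewrite (snormN hip).
  have [Vb Ub] := bound' r rT.
  apply: le_trans (ler_snormD hip _ _) _; apply: lerD.
    apply: le_trans (l2_mul_norm md Da0 dDe _) _; rewrite ler_wpM2l //.
    by rewrite -(ger0_norm (snorm_ge0 _ _)) -sqrtr_sqr ler_wsqrtr.
  apply: le_trans (l2_mul_norm me Db0 eDe _) _; rewrite ler_wpM2l //.
  by rewrite -(ger0_norm (snorm_ge0 _ _)) -sqrtr_sqr ler_wsqrtr.
have := @energy_data_estimate R T _ ip T_gt0 hip e (fun n => lambda n `^ s)
    ortho complete mu0 mA mB A B
    (l2_mulB ma A0 aAe) (l2_mul_sym ma A0 aAe)
    (fun w => l2_mul_ge0 ma A0 aAe w (fun x => pos a x a0))
    (l2_mul_norm ma A0 aAe)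
    (fun w => l2_mul_ge0 mb B0 bBe w (fun x => pos b x b0))
    (l2_mul_norm mb B0 bBe)
    (fun r => U r - U' r) (fun r => V r - V' r) f F (k0 ^+ 2).
rewrite Ed => H; apply: (H _ _ _ fF _ c0 k1 t c0_gt0 c0_le A0 _ tT).2.
- by move=> r rT; apply: (vderivB hip); [exact: du|exact: du'].
- move=> r rT; have FF := time_nbhs_filter T r.
  exact: (scvgB hip (cv r rT) (cv' r rT)).
- move=> n r rT.
  have D1 := eqn n r rT; have D2 := tderivZ (c := -1) (eqn' n r rT).
  have := tderivD D1 D2.
  have -> : (fun r => ip (l2_part c (v r)) (e n) + -1 * ip (l2_part c (v' r)) (e n))
      = (fun r => ip (V r - V' r) (e n)).
    by apply/funext => r'; rewrite (ipBl hip) mulN1r.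
  congr (tderiv T _ r _).
  rewrite /f (l2_mul_part_sub _ aoo aoo' doo A0 A0' Da0 aA aA' dD).
  rewrite (l2_mul_part_sub _ boo boo' eoo B0 B0' Db0 bB bB' eD).
  have mAs p p' : mA (p - p') = mA p - mA p' by exact: (l2_mulB ma A0 aAe).
  have mBs p p' : mB (p - p') = mB p - mB p' by exact: (l2_mulB mb B0 bBe).
  rewrite mAs mBs opprK !(ipDl hip, ipNl hip).
  rewrite -/(U r) -/(V r) -/(U' r) -/(V' r) -/mA -/mB -/mA' -/mB'.
  move: (ip (U r) (e n)) (ip (U' r) (e n)) (ip (mA (U r)) (e n))
    (ip (mB (V r)) (e n)) (ip (mA' (U' r)) (e n)) (ip (mB' (V' r)) (e n))
    (ip (mA (U' r)) (e n)) (ip (mB (V' r)) (e n)) => *.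
  ring.
- move=> n; have [L2d0 Ed0] := L2_sub w0.1 w0'.1.
  have -> : \sum_(i < n) lambda i `^ s * ip (U 0 - U' 0) (e i) ^+ 2 =
      \sum_(i < n) lambda i `^ s *
        ip (l2_part c (fun x => u0 x - u0' x)) (e i) ^+ 2.
    by apply: eq_bigr => i _; rewrite Ed0 !(ipBl hip) ic0 ic0'.
  exact: (W_coef hphi hlambda c n w0d k0P).
- have [L2d1 Ed1] := L2_sub h1 h1'.
  apply: (snorm_coef_le (c := c) L2d1 k1P) => n.
  by rewrite Ed1 !(ipBl hip) ic1 ic1'.
Qed.

End TwoSolutions.
End Comparison.

(** * Moderate and negligible nets *)

Section Nets.
Context (R : realType).
Implicit Types (X : set (R -> R[i])) (nrm : (R -> R[i]) -> \bar R).

(** Every large enough integer serves both as the exponent and as the constant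
    in the bound of a moderate net. *)
Lemma moderate_net_near X nrm net : moderate_net X nrm net ->
  \forall N \near \oo, forall eps : R, 0 < eps <= 1 ->
    X (net eps) /\ (nrm (net eps) <= (N%:R * eps ^- N)%:E)%E.
Proof.
move=> [netX [N0 [C [C0 H]]]]; near=> N => eps e01; split; first exact: netX.
apply: le_trans (H eps e01) _; rewrite lee_fin; case/andP: e01 => e0 e1.
have NN0 : (N0 <= N)%N by near: N; exact: nbhs_infty_ge.
have CN : C <= N%:R by near: N; exact: nbhs_infty_ger.
have E0 : 0 <= eps ^- N0 by rewrite invr_ge0 exprn_ge0 // ltW.
by rewrite ler_pM ?(ltW C0) // -!exprVn ler_weXn2l // -invr1 lef_pV2 ?posrE.
Unshelve. all: by end_near. Qed.

Lemma negligible_net_near X nrm net (k : R) : negligible_net X nrm net -> 0 < k ->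
  \forall M \near \oo, forall eps : R, 0 < eps <= 1 ->
    X (net eps) /\ (nrm (net eps) <= (M%:R * eps `^ k)%:E)%E.
Proof.
move=> [netX H] k0; have [D [D0 HD]] := H k k0.
near=> M => eps e01; split; first exact: netX.
apply: le_trans (HD eps e01) _; rewrite lee_fin ler_wpM2r ?powR_ge0 //.
by near: M; exact: nbhs_infty_ger.
Unshelve. all: by end_near. Qed.

(** The arithmetic of the estimate: coefficients and data of the reference
    problem of size [C * X] cost the fourth power of [X], which differences of
    size [D * (d / X ^ 2)] absorb. *)
Lemma bound_arith (T c0 C D : R) : 0 < c0 -> 0 <= C -> 0 <= D ->
  exists L : R, 0 <= L /\ forall X d : R, 1 <= X -> 0 <= d ->
    exists F : R,
      D * (d / X ^+ 2) * Num.sqrt (position_bound T c0 (C * X) (C * X) (C * X))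
      + D * (d / X ^+ 2) * Num.sqrt (velocity_bound c0 (C * X) (C * X) (C * X))
        <= F /\
      2 * (c0^-1 * (D * (d / X ^+ 2)) ^+ 2)
      + 2 * T ^+ 2 * (velocity_bound c0 (C * X) (D * (d / X ^+ 2)) (D * (d / X ^+ 2))
                      + 4 * T ^+ 2 * F ^+ 2) <= L * d ^+ 2.
Proof.
move=> c0_gt0 C0 D0; rewrite /position_bound /velocity_bound.
have : 0 <= c0^-1 by rewrite invr_ge0 ltW.
move: (c0^-1) => ci ci0.
have [T2 C2 D2] := And3 (sqr_ge0 T) (sqr_ge0 C) (sqr_ge0 D).
pose K1 := 2 * (2 * C ^+ 2 + ci * C ^+ 3).
pose K := K1 + (2 * ci * C ^+ 2 + 2 * T ^+ 2 * K1).
have K10 : 0 <= K1 by rewrite /K1 mulr_ge0 // addr_ge0 ?mulr_ge0 ?exprn_ge0.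
have K20 : 0 <= 2 * ci * C ^+ 2 + 2 * T ^+ 2 * K1.
  by apply: addr_ge0; apply: mulr_ge0 => //; apply: mulr_ge0.
have K0 : 0 <= K by rewrite addr_ge0.
pose L := 2 * ci * D ^+ 2
  + 2 * T ^+ 2 * (2 * (2 + C * ci) * D ^+ 2 + 16 * T ^+ 2 * D ^+ 2 * K).
exists L; split.
  rewrite /L; apply: addr_ge0; apply: mulr_ge0 => //; try exact: mulr_ge0.
  apply: addr_ge0; apply: mulr_ge0 => //; apply: mulr_ge0 => //.
    by apply: addr_ge0 => //; exact: mulr_ge0.
  exact: mulr_ge0.
move=> X d X1 d0.
have X0 : 0 < X by exact: lt_le_trans ltr01 X1.
have X4 n : (n <= 4)%N -> X ^+ n <= X ^+ 4 by move=> n4; rewrite ler_weXn2l.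
set r := d / X ^+ 2.
have rX : r * X ^+ 2 = d by rewrite /r divfK // expf_neq0 // gt_eqF.
have r0 : 0 <= r by rewrite /r divr_ge0 // sqr_ge0.
have d2 : d ^+ 2 = r ^+ 2 * X ^+ 4 by rewrite -rX; ring.
have V4 : 2 * ((C * X) ^+ 2 + (C * X) ^+ 2 + C * X * (ci * (C * X) ^+ 2))
    <= K1 * X ^+ 4.
  have -> : 2 * ((C * X) ^+ 2 + (C * X) ^+ 2 + C * X * (ci * (C * X) ^+ 2)) =
    4 * C ^+ 2 * X ^+ 2 + 2 * ci * C ^+ 3 * X ^+ 3 by ring.
  have -> : K1 * X ^+ 4 = 4 * C ^+ 2 * X ^+ 4 + 2 * ci * C ^+ 3 * X ^+ 4.
    by rewrite /K1; ring.
  by rewrite lerD // ler_wpM2l ?X4 // !mulr_ge0 ?exprn_ge0.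
have P4 : 2 * (ci * (C * X) ^+ 2) + 2 * T ^+ 2 *
    (2 * ((C * X) ^+ 2 + (C * X) ^+ 2 + C * X * (ci * (C * X) ^+ 2))) <=
    (2 * ci * C ^+ 2 + 2 * T ^+ 2 * K1) * X ^+ 4.
  rewrite [leRHS]mulrDl; apply: lerD.
    have -> : 2 * (ci * (C * X) ^+ 2) = 2 * ci * C ^+ 2 * X ^+ 2 by ring.
    by rewrite ler_wpM2l ?X4 // !mulr_ge0 ?sqr_ge0.
  by rewrite -[leRHS]mulrA ler_wpM2l // mulr_ge0 ?sqr_ge0.
have X40 : 0 <= X ^+ 4 by rewrite exprn_ge0 // ltW.
have sq Y : Y <= K * X ^+ 4 -> Num.sqrt Y <= Num.sqrt K * X ^+ 2.
  move=> YK; rewrite -[X ^+ 2]ger0_norm ?sqr_ge0 // -sqrtr_sqr -sqrtrM //.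
  by rewrite ler_wsqrtr // -exprM.
exists (2 * D * Num.sqrt K * d); split.
  have -> : 2 * D * Num.sqrt K * d = D * r * (Num.sqrt K * X ^+ 2)
    + D * r * (Num.sqrt K * X ^+ 2) by rewrite -rX; ring.
  have Dr0 : 0 <= D * r by exact: mulr_ge0.
  apply: lerD; apply: (ler_wpM2l Dr0); apply: sq.
    by apply: le_trans P4 _; rewrite ler_wpM2r // /K lerDr.
  by apply: le_trans V4 _; rewrite ler_wpM2r // /K lerDl.
have F2 : (2 * D * Num.sqrt K * d) ^+ 2 = 4 * D ^+ 2 * K * d ^+ 2.
  by rewrite !exprMn sqr_sqrtr //; ring.
rewrite F2.
have rd n : (n <= 4)%N -> r ^+ 2 * X ^+ n <= d ^+ 2.
  by move=> n4; rewrite d2 ler_wpM2l ?sqr_ge0 ?X4.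
have r1 : r ^+ 2 <= d ^+ 2 by have := rd 0%N isT; rewrite expr0 mulr1.
have r2 : r ^+ 2 * X <= d ^+ 2 by exact: (rd 1%N isT).
have -> : L * d ^+ 2 = 2 * ci * D ^+ 2 * d ^+ 2
  + 2 * T ^+ 2 * (4 * D ^+ 2 * d ^+ 2 + 2 * C * ci * D ^+ 2 * d ^+ 2
      + 4 * T ^+ 2 * (4 * D ^+ 2 * K * d ^+ 2)) by rewrite /L; ring.
have -> : 2 * (ci * (D * r) ^+ 2) = 2 * ci * D ^+ 2 * r ^+ 2 by ring.
have -> : 2 * ((D * r) ^+ 2 + (D * r) ^+ 2 + C * X * (ci * (D * r) ^+ 2)) =
  4 * D ^+ 2 * r ^+ 2 + 2 * C * ci * D ^+ 2 * (r ^+ 2 * X) by ring.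
apply: lerD; first by rewrite ler_wpM2l // !mulr_ge0 ?sqr_ge0.
apply: ler_wpM2l; first by rewrite mulr_ge0 ?sqr_ge0.
rewrite lerD2r; apply: lerD; rewrite ler_wpM2l // !mulr_ge0 ?sqr_ge0 //.
Qed.

End Nets.

Theorem theorem4p2 (R : realType) (T s : R) (hT : 0 < T) (hs : 0 <= s)
  (q : R -> R) (hq : Loo (toC q))
  (lambda : nat -> R) (phi : nat -> R -> R)
  (hphi : SL_eigenbasis q lambda phi)
  (hlambda : forall n, 0 < lambda n)
  (a b u0 u1 : (R -> R) -> complex R)
  (ha : distribution_on unit_itv a) (hb : distribution_on unit_itv b)
  (hu0 : distribution_on unit_itv u0) (hu1 : distribution_on unit_itv u1)
  (ha0 : nonneg_distribution unit_itv a)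
  (hb0 : nonneg_distribution unit_itv b)
  (hareg : exists ae, [/\ regularisation a ae, nonneg_net ae &
     moderate_net (@Loo R) (@Loo_norm R) ae])
  (hbreg : exists be, [/\ regularisation b be, nonneg_net be &
     moderate_net (@Loo R) (@Loo_norm R) be])
  (hu0reg : exists u0e, regularisation u0 u0e /\
     moderate_net (W q lambda phi s) (W_norm lambda phi s) u0e)
  (hu1reg : exists u1e, regularisation u1 u1e /\
     moderate_net (@L2 R) (@L2_norm R) u1e) :
  forall (ae ae' be be' u0e u0e' u1e u1e' : R -> R -> complex R),
    [/\ regularisation a ae, nonneg_net ae &
        moderate_net (@Loo R) (@Loo_norm R) ae] ->
    [/\ regularisation a ae', nonneg_net ae' &
        moderate_net (@Loo R) (@Loo_norm R) ae'] ->
    [/\ regularisation b be, nonneg_net be &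
        moderate_net (@Loo R) (@Loo_norm R) be] ->
    [/\ regularisation b be', nonneg_net be' &
        moderate_net (@Loo R) (@Loo_norm R) be'] ->
    regularisation u0 u0e /\
      moderate_net (W q lambda phi s) (W_norm lambda phi s) u0e ->
    regularisation u0 u0e' /\
      moderate_net (W q lambda phi s) (W_norm lambda phi s) u0e' ->
    regularisation u1 u1e /\ moderate_net (@L2 R) (@L2_norm R) u1e ->
    regularisation u1 u1e' /\ moderate_net (@L2 R) (@L2_norm R) u1e' ->
    negligible_net (@Loo R) (@Loo_norm R) (net_sub ae ae') ->
    negligible_net (@Loo R) (@Loo_norm R) (net_sub be be') ->
    negligible_net (W q lambda phi s) (W_norm lambda phi s) (net_sub u0e u0e') ->
    negligible_net (@L2 R) (@L2_norm R) (net_sub u1e u1e') ->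
  forall (u u' : R -> R -> R -> complex R),
    (forall eps : R, 0 < eps <= 1 ->
       wave_solution q lambda phi T s (ae eps) (be eps) (u0e eps) (u1e eps)
         (u eps)) ->
    (forall eps : R, 0 < eps <= 1 ->
       wave_solution q lambda phi T s (ae' eps) (be' eps) (u0e' eps) (u1e' eps)
         (u' eps)) ->
  forall t : R, 0 <= t <= T ->
    negligible_net (@L2 R) (@L2_norm R) (fun eps x => u eps t x - u' eps t x).
Proof.
move=> ae ae' be be' u0e u0e' u1e u1e' [_ a0 aM] [_ a0' aM'] [_ b0 bM] [_ b0' bM'].
move=> [_ u0M] [_ u0M'] [_ u1M] [_ u1M'] aN bN u0N u1N u u' sol sol' t tT.
have [c c_gt0 c_le] := eigenvalue_lower_bound hq hphi hlambda.
have c0_gt0 : 0 < c `^ s by exact: powR_gt0.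
have c0_le n : c `^ s <= lambda n `^ s.
  by apply: ge0_ler_powR; rewrite ?nnegrE ?(ltW c_gt0) ?(ltW (hlambda n)) ?c_le.
have diff2 eps : 0 < eps <= 1 -> L2 (fun x => u eps t x - u' eps t x).
  move=> e01; have [_ [v [cu _ _ _]]] := sol eps e01.
  have [_ [v' [cu' _ _ _]]] := sol' eps e01.
  exact: (L2_sub (cu t tT).1 (cu' t tT).1).1.
split; first exact: diff2.
move=> k k_gt0.
have [N _ /(_ N (leqnn N))[HA [HA' [HB [HB' [H0 H1]]]]]] :=
  filterI (moderate_net_near aM) (filterI (moderate_net_near aM')
    (filterI (moderate_net_near bM) (filterI (moderate_net_near bM')
      (filterI (moderate_net_near u0M') (moderate_net_near u1M'))))).
(* the differences gain the factor that the moderate quantities cost *)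
pose p := k + (N + N)%:R.
have p_gt0 : 0 < p by rewrite ltr_wpDr.
have [M _ /(_ M (leqnn M))[HDa [HDb [HD0 HD1]]]] :=
  filterI (negligible_net_near aN p_gt0) (filterI (negligible_net_near bN p_gt0)
    (filterI (negligible_net_near u0N p_gt0) (negligible_net_near u1N p_gt0))).
pose C : R := N%:R; pose D : R := M%:R.
have C_ge0 : 0 <= C by exact: ler0n.
have D_ge0 : 0 <= D by exact: ler0n.
have [L [L0 HL]] := bound_arith T c0_gt0 C_ge0 D_ge0.
exists (Num.sqrt (2 * L) + 1); split.
  by rewrite ltr_wpDl ?sqrtr_ge0.
move=> eps e01; have [e0 e1] := andP e01.
pose X := eps ^- N; pose d := eps `^ k.
have X1 : 1 <= X by rewrite /X -exprVn exprn_ege1 // -invr1 lef_pV2 ?posrE.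
have X0 : 0 <= X by exact: le_trans ler01 X1.
have d0 : 0 <= d by exact: powR_ge0.
have pE : eps `^ p = d / X ^+ 2.
  rewrite /p powRD; last by rewrite gt_eqF ?implybT // (gt_eqF e0) implybT.
  rewrite powR_mulrn ?(ltW e0) // exprD /X.
  by congr (_ * _); rewrite exprVn invrK expr2.
have CX0 : 0 <= C * X by exact: mulr_ge0.
have Dd0 : 0 <= D * (d / X ^+ 2).
  by rewrite mulr_ge0 // divr_ge0 // sqr_ge0.
have [Aoo An] := HA eps e01; have [Aoo' An'] := HA' eps e01.
have [Boo Bn] := HB eps e01; have [Boo' Bn'] := HB' eps e01.
have [W0 W0n] := H0 eps e01; have [V1 V1n] := H1 eps e01.
have [Doo Dn] := HDa eps e01; have [Eoo En] := HDb eps e01.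
have [W0d W0dn] := HD0 eps e01; have [V1d V1dn] := HD1 eps e01.
rewrite pE in Dn En W0dn V1dn.
have [F [HF HLF]] := HL X d X1 d0.
have bound b := (difference_bound hT hphi hlambda c0_gt0 c0_le
  (fun x => a0 eps x e01) (fun x => a0' eps x e01)
  (fun x => b0 eps x e01) (fun x => b0' eps x e01)
  Aoo Aoo' Boo Boo' Doo Eoo CX0 CX0 CX0 CX0 Dd0 Dd0
  An An' Bn Bn' Dn En (u0M.1 eps e01) W0 W0d (u1M.1 eps e01) V1 W0n V1n W0dn V1dn
  (sol eps e01) (sol' eps e01) b tT HF).2.
have le_L b := le_trans (bound b) HLF.
rewrite (L2_normP (diff2 eps e01)) lee_fin.
apply: (@le_trans _ _ (Num.sqrt (2 * L) * d)); last first.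
  by rewrite ler_wpM2r // lerDl.
rewrite -[X in _ * X](ger0_norm d0) -sqrtr_sqr -sqrtrM ?mulr_ge0 //.
rewrite ler_wsqrtr // -mulrA mulrDl !mul1r.
by apply: lerD; exact: le_L.
Qed.
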